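(* Let $n,m,s,N$ be positive integers with $s\le m$, $n>2s$ and $\frac{n-1}{n-2s}\leq N\leq s$. Then for almost all $\lambda_0\in\mathbb{C}^n$, almost all $A\in\mathbb{C}^{n\times m}$, and almost all $X_0\in\mathbb{C}^{m\times N}$ with $s$ nonzero rows, the pair $(\lambda_0,X_0)$ is identifiable up to scaling in the BGPC problem with a joint sparsity constraint: whenever $\lambda\in\mathbb{C}^n$ and $X\in\mathbb{C}^{m\times N}$ with at most $s$ nonzero rows satisfy $\operatorname{diag}(\lambda)AX=\operatorname{diag}(\lambda_0)AX_0$, there exists a nonzero $\sigma\in\mathbb{C}$ with $\lambda=\sigma\lambda_0$ and $X=\frac{1}{\sigma}X_0$.
   Context: $\operatorname{diag}(\lambda)$ denotes the $n\times n$ diagonal matrix with the entries of $\lambda$ on its diagonal. The BGPC problem with a joint sparsity constraint is: given $A$ and $Y=\operatorname{diag}(\lambda_0)AX_0$, find $(\lambda,X)$ with $\lambda\in\mathbb{C}^n$, $X\in\mathbb{C}^{m\times N}$ having at most $s$ nonzero rows (columns jointly $s$-sparse), and $\operatorname{diag}(\lambda)AX=Y$. ''Almost all $X_0$ with $s$ nonzero rows'' means: for each index set $J_0\subset\{1,\dots,m\}$ with $|J_0|=s$, the statement holds for all $X_0$ whose rows outside $J_0$ vanish, except for those whose submatrix of rows indexed by $J_0$ lies in a Lebesgue-null subset of $\mathbb{C}^{s\times N}$; ''almost all'' for $\lambda_0$ and $A$ is with respect to Lebesgue measure on $\mathbb{C}^n$ and $\mathbb{C}^{n\times m}$ (identifying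 $\mathbb{C}\cong\mathbb{R}^2$). *)

(* Defs.v *)
From Stdlib Require Import Reals List Arith.
Import ListNotations.
Open Scope R_scope.

Definition Cx : Type := (R * R)%type.
Definition C0 : Cx := (0, 0).
Definition Cadd (x y : Cx) : Cx := (fst x + fst y, snd x + snd y).
Definition Cmul (x y : Cx) : Cx :=
  (fst x * fst y - snd x * snd y, fst x * snd y + snd x * fst y).
Definition Cinv (x : Cx) : Cx :=
  let d := fst x * fst x + snd x * snd x in (fst x / d, - snd x / d).

Fixpoint Csum (n : nat) (f : nat -> Cx) : Cx :=
  match n with
  | O => C0
  | S k => Cadd (Csum k f) (f k)
  end.

(** Vectors in C^n are functions nat -> Cx (only indices < n matter);
    matrices in C^{p x q} are functions nat -> nat -> Cx (only i<p, j<q matter). *)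

Definition diagAX (m : nat) (lam : nat -> Cx) (A X : nat -> nat -> Cx)
  : nat -> nat -> Cx :=
  fun i j => Cmul (lam i) (Csum m (fun k => Cmul (A i k) (X k j))).

Definition nonzero_row (N : nat) (X : nat -> nat -> Cx) (k : nat) : Prop :=
  exists j, (j < N)%nat /\ X k j <> C0.

Definition at_most_s_rows (m N s : nat) (X : nat -> nat -> Cx) : Prop :=
  exists J : list nat, (length J <= s)%nat /\
    forall k, (k < m)%nat -> nonzero_row N X k -> In k J.

(** Lebesgue-null subsets of C^dom (identified with R^(2 |dom|)), for a
    duplicate-free list of coordinates dom of an index type I: for every
    eps > 0 there is a countable family of closed boxes covering E whose total
    volume is at most eps. *)
Definition box_vol {I : Type} (dom : list I) (a b : I -> Cx) : R :=
  fold_right (fun i acc => (fst (b i) - fst (a i)) * (snd (b i) - snd (a i)) * acc)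
    1 dom.

Definition in_box {I : Type} (dom : list I) (a b z : I -> Cx) : Prop :=
  forall i, In i dom ->
    (fst (a i) <= fst (z i) <= fst (b i)) /\ (snd (a i) <= snd (z i) <= snd (b i)).

Definition null_set {I : Type} (dom : list I) (E : (I -> Cx) -> Prop) : Prop :=
  forall eps, 0 < eps ->
    exists a b : nat -> I -> Cx,
      (forall k i, In i dom -> fst (a k i) <= fst (b k i) /\ snd (a k i) <= snd (b k i)) /\
      (forall K, sum_f_R0 (fun k => box_vol dom (a k) (b k)) K <= eps) /\
      (forall z, E z -> exists k, in_box dom (a k) (b k) z).

(** Coordinates of the joint parameter space C^n x C^{n x m} x C^{s x N}. *)
Inductive idx : Type :=
| Ilam (i : nat)
| IA (i k : nat)
| IY (r j : nat).

Definition dom_param (n m s N : nat) : list idx :=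
  map Ilam (seq 0 n)
  ++ flat_map (fun i => map (IA i) (seq 0 m)) (seq 0 n)
  ++ flat_map (fun r => map (IY r) (seq 0 N)) (seq 0 s).

Definition pack (lam : nat -> Cx) (A Y : nat -> nat -> Cx) : idx -> Cx :=
  fun z => match z with
           | Ilam i => lam i
           | IA i k => A i k
           | IY r j => Y r j
           end.

(* Main.v *)
(** The bad parameters lie in finitely many zero sets of nonzero polynomials.

    Put gamma_i = lambda0_i / lambda_i and let K contain J0 and the row support of X, so that
    t = |K| <= 2s.  The equation becomes A_K X_K = diag(gamma) A_J0 X0_J0, linear in (gamma, X_K), and
    identifiability says that its only solutions are the multiples of gamma = 1, X = X0.  After
    normalising gamma_0 = 0 this is injectivity of a matrix with polynomial entries, hence holds
    generically as soon as it holds for one choice of A and X0.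

    Such a choice: let X0_J0 have the identity as its first N rows and let the columns of A_K be
    characters i |-> omega^(i e) of Z/n, with distinct exponents e that include 1, ..., N.  If -f is
    not one of these exponents, pairing the equation with omega^(i f) kills the left side and shows
    that the Fourier coefficients of gamma at f + 1, ..., f + N vanish.  As N (n - t) >= n - 1, n - t
    values of f suffice to reach all nonzero frequencies, so gamma is constant. *)

From Stdlib Require Import Reals List Arith Lra Lia ClassicalEpsilon Permutation FinFun.
From Coquelicot Require Import Complex.
Require Import Defs.
Import ListNotations.
Open Scope R_scope.

(** * Polynomial functions of several complex variables *)

(** Polynomials of one variable through divided differences instead of coefficients: dividing out
    [t - x] lowers the degree bound by one. The sublevel estimate uses exactly this factorisation,
    at a point [x] chosen freely. *)
Fixpoint deg_le (D : nat) (p : C -> C) : Prop :=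
  match D with
  | O => forall t u, p t = p u
  | S D' => forall x, exists q, deg_le D' q /\ forall t, p t = (p x + (t - x) * q t)%C
  end.

Lemma deg_le_ext D p q : (forall t, p t = q t) -> deg_le D p -> deg_le D q.
Proof.
  destruct D as [|D]; simpl; intros E H.
  - intros t u. rewrite <- !E. apply H.
  - intros x. destruct (H x) as [r [Hr E']]. exists r. split; [exact Hr|].
    intros t. rewrite <- !E. apply E'.
Qed.

Lemma deg_le_const D c : deg_le D (fun _ => c).
Proof.
  revert c; induction D as [|D IH]; simpl; intros c; [reflexivity|].
  intros x. exists (fun _ => RtoC 0). split; [apply IH | intros t; ring].
Qed.

Lemma deg_le_S D p : deg_le D p -> deg_le (S D) p.
Proof.
  revert p; induction D as [|D IH]; intros p H x.
  - exists (fun _ => RtoC 0). split; [easy|]. intros t. rewrite (H t x). ring.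
  - destruct (H x) as [q [Hq E]]. exists q. split; [apply IH, Hq | exact E].
Qed.

Lemma deg_le_mono D D' p : (D <= D')%nat -> deg_le D p -> deg_le D' p.
Proof. induction 1; intros H0; [exact H0 | apply deg_le_S; auto]. Qed.

Lemma deg_le_add D p q : deg_le D p -> deg_le D q -> deg_le D (fun t => p t + q t)%C.
Proof.
  revert p q; induction D as [|D IH]; simpl; intros p q Hp Hq.
  - intros t u. now rewrite (Hp t u), (Hq t u).
  - intros x. destruct (Hp x) as [p' [Hp' Ep]], (Hq x) as [q' [Hq' Eq]].
    exists (fun t => p' t + q' t)%C. split; [now apply IH|].
    intros t. rewrite (Ep t), (Eq t). ring.
Qed.

Lemma deg_le_scal D c p : deg_le D p -> deg_le D (fun t => c * p t)%C.
Proof.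
  revert p; induction D as [|D IH]; simpl; intros p Hp.
  - intros t u. now rewrite (Hp t u).
  - intros x. destruct (Hp x) as [p' [Hp' Ep]].
    exists (fun t => c * p' t)%C. split; [now apply IH|].
    intros t. rewrite (Ep t). ring.
Qed.

Lemma deg_le_mul D D' p q :
  deg_le D p -> deg_le D' q -> deg_le (D + D') (fun t => p t * q t)%C.
Proof.
  revert D' p q; induction D as [|D IH]; intros D' p q Hp Hq.
  - apply deg_le_ext with (fun t => p 0 * q t)%C; [|now apply deg_le_scal].
    intros t. now rewrite (Hp t 0).
  - destruct D' as [|D'].
    + rewrite Nat.add_0_r. apply deg_le_ext with (fun t => q 0 * p t)%C; [|now apply deg_le_scal].
      intros t. rewrite (Hq t 0). ring.
    + intros x. destruct (Hp x) as [p' [Hp' Ep]], (Hq x) as [q' [Hq' Eq]].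
      (* Leibniz rule for divided differences; each summand has degree at most [D + S D']. *)
      exists (fun t => p' t * q t + p x * q' t)%C. split.
      * apply deg_le_add; [now apply IH|].
        apply deg_le_scal, deg_le_mono with D'; [lia | exact Hq'].
      * intros t. rewrite (Ep t), (Eq t). ring.
Qed.

Lemma deg_le_id : deg_le 1 (fun t => t).
Proof. intros x. exists (fun _ => RtoC 1). split; [easy | intros t; ring]. Qed.

Lemma Cmod_minus_ge (x y : C) : Cmod x - Cmod y <= Cmod (x - y).
Proof.
  assert (H := Cmod_triangle (x - y) y). replace (x - y + y)%C with x in H by ring. lra.
Qed.

Lemma Cmod_minus_le (x y : C) : Cmod (x - y) <= Cmod x + Cmod y.
Proof. unfold Cminus. rewrite <- (Cmod_opp y). apply Cmod_triangle. Qed.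

(* Peeling off one small value x of p at a time: p = p x + (t - x) q leaves a q of smaller degree
   that is still bounded below at w and is small wherever p is small, away from x. *)
Lemma deg_le_sublevel D :
  forall r delta B, 0 < r -> 0 < delta -> 0 < B ->
  exists eps, 0 < eps /\
    forall p w, deg_le D p -> Cmod w <= B -> delta < Cmod (p w) ->
    exists l : list C, (length l <= D)%nat /\
      forall t, Cmod t <= B -> Cmod (p t) <= eps -> exists x, In x l /\ Cmod (t - x) <= r.
Proof.
  induction D as [|D IH]; intros r delta B Hr Hd HB.
  - exists (delta / 2). split; [lra|]. intros p w Hp _ Hw. exists []. split; [auto|].
    intros t _ Ht. rewrite (Hp t w) in Ht. lra.
  - destruct (IH r (delta / (4 * B)) B Hr) as [e [He IHe]];
      [apply Rdiv_lt_0_compat; lra | exact HB |].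
    (* The bound [delta / 2] on [p x] leaves more than [delta / 2] for [(w - x) * q w], and
       [Cmod (w - x) <= 2 * B], so [q w] exceeds [delta / (4 * B)]. The bound [r * e / 2] on both
       [p x] and [p t] keeps [(t - x) * q t] below [r * e], so that [q t] is at most [e] once [t] is
       farther than [r] from [x]. *)
    exists (Rmin (delta / 2) (r * e / 2)).
    assert (Hre : 0 < r * e) by (apply Rmult_lt_0_compat; lra).
    split; [apply Rmin_glb_lt; lra|].
    intros p w Hp Hw Hpw.
    destruct (classic (exists x, Cmod x <= B /\ Cmod (p x) <= Rmin (delta / 2) (r * e / 2)))
      as [[x [Hx Hpx]]|Hno].
    2:{ exists []. split; [simpl; lia|]. intros t Ht1 Ht2. destruct Hno. now exists t. }
    assert (Hpx1 := Rle_trans _ _ _ Hpx (Rmin_l _ _)).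
    assert (Hpx2 := Rle_trans _ _ _ Hpx (Rmin_r _ _)).
    destruct (Hp x) as [q [Hq Eq]].
    destruct (IHe q w Hq Hw) as [l [Hl Hcov]].
    { assert (H1 := Cmod_minus_ge (p w) (p x)).
      replace (p w - p x)%C with ((w - x) * q w)%C in H1 by (rewrite (Eq w); ring).
      rewrite Cmod_mult in H1.
      assert (H2 := Cmod_minus_le w x).
      assert (H3 := Cmod_ge_0 (q w)).
      apply Rmult_lt_reg_r with (4 * B); [lra|].
      unfold Rdiv. rewrite Rmult_assoc, Rinv_l, Rmult_1_r by lra.
      assert (Cmod (w - x) * Cmod (q w) <= 2 * B * Cmod (q w))
        by (apply Rmult_le_compat_r; lra).
      lra. }
    exists (x :: l). split; [simpl; lia|].
    intros t Ht Hpt.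
    assert (Hpt2 := Rle_trans _ _ _ Hpt (Rmin_r _ _)).
    destruct (Rle_lt_dec (Cmod (t - x)) r) as [H|H].
    + exists x. split; [now left | exact H].
    + destruct (Hcov t Ht) as [y [Hy1 Hy2]].
      * assert (H1 := Cmod_minus_le (p t) (p x)).
        replace (p t - p x)%C with ((t - x) * q t)%C in H1 by (rewrite (Eq t); ring).
        rewrite Cmod_mult in H1.
        destruct (Rle_lt_dec (Cmod (q t)) e) as [|H2]; [assumption|].
        assert (r * e < Cmod (t - x) * Cmod (q t)); [|lra].
        apply Rmult_gt_0_lt_compat; lra.
      * exists y. split; [now right | exact Hy2].
Qed.

(** * Functions of many variables and their restriction to lines *)

Definition upd {I : Type} (z : I -> C) (i : I) (t : C) : I -> C :=
  fun j => if excluded_middle_informative (j = i) then t else z j.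

Lemma upd_same {I : Type} (z : I -> C) i t : upd z i t i = t.
Proof. unfold upd. now destruct excluded_middle_informative. Qed.

Lemma upd_other {I : Type} (z : I -> C) i j t : j <> i -> upd z i t j = z j.
Proof. unfold upd. now destruct excluded_middle_informative. Qed.

(** [D] records which coordinates may occur. This makes induction on the number of variables
    possible while every function keeps the same domain [I -> C]. *)
Inductive polyfun {I : Type} (D : I -> Prop) : ((I -> C) -> C) -> Prop :=
| pf_const c : polyfun D (fun _ => c)
| pf_coord i : D i -> polyfun D (fun z => z i)
| pf_add f g : polyfun D f -> polyfun D g -> polyfun D (fun z => f z + g z)%C
| pf_mul f g : polyfun D f -> polyfun D g -> polyfun D (fun z => f z * g z)%C.

Lemma polyfun_local {I : Type} (D : I -> Prop) f :
  polyfun D f -> forall z z', (forall i, D i -> z i = z' i) -> f z = f z'.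
Proof.
  induction 1; intros z z' E; auto.
  - now rewrite (IHpolyfun1 z z'), (IHpolyfun2 z z').
  - now rewrite (IHpolyfun1 z z'), (IHpolyfun2 z z').
Qed.

Lemma polyfun_upd_const {I : Type} (D D' : I -> Prop) f i c :
  (forall j, D j -> j <> i -> D' j) ->
  polyfun D f -> polyfun D' (fun z => f (upd z i c)).
Proof.
  intros HD. induction 1 as [d|j Hj|f g _ IHf _ IHg|f g _ IHf _ IHg].
  - apply pf_const.
  - unfold upd. destruct (excluded_middle_informative (j = i)).
    + apply pf_const.
    + apply pf_coord. auto.
  - now apply (pf_add D' (fun z => f (upd z i c)) (fun z => g (upd z i c))).
  - now apply (pf_mul D' (fun z => f (upd z i c)) (fun z => g (upd z i c))).
Qed.

(** The degree bound comes before the base point [z]: the later estimates on parallel lines depend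
    on the line only through this common [d]. *)
Lemma polyfun_line_deg {I : Type} (D : I -> Prop) f i :
  polyfun D f -> exists d, forall z, deg_le d (fun t => f (upd z i t)).
Proof.
  induction 1 as [c|j Hj|f g _ [df IHf] _ [dg IHg]|f g _ [df IHf] _ [dg IHg]].
  - exists 0%nat. intros z. apply deg_le_const.
  - exists 1%nat. intros z. unfold upd. destruct excluded_middle_informative.
    + apply deg_le_id.
    + apply deg_le_const.
  - exists (Nat.max df dg). intros z.
    apply deg_le_add; [apply deg_le_mono with df | apply deg_le_mono with dg]; auto; lia.
  - exists (df + dg)%nat. intros z. now apply (deg_le_mul df dg).
Qed.

Lemma polyfun_bounded {I : Type} (D : I -> Prop) f B :
  polyfun D f -> 0 < B ->
  exists K, 0 < K /\ forall z, (forall i, D i -> Cmod (z i) <= B) -> Cmod (f z) <= K.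
Proof.
  intros H HB. induction H as [c|j Hj|f g _ [K [HK IHf]] _ [L [HL IHg]]|f g _ [K [HK IHf]] _ [L [HL IHg]]].
  - exists (Cmod c + 1). split; [assert (H := Cmod_ge_0 c); lra|]. intros; lra.
  - exists B. auto.
  - exists (K + L). split; [lra|]. intros z Hz.
    assert (H1 := IHf z Hz). assert (H2 := IHg z Hz). assert (H3 := Cmod_triangle (f z) (g z)). lra.
  - exists (K * L). split; [now apply Rmult_lt_0_compat|]. intros z Hz.
    rewrite Cmod_mult. apply Rmult_le_compat; auto using Cmod_ge_0.
Qed.

(** This carries smallness of [f] from one point of a grid cell to a chosen representative of the
    cell. *)
Lemma polyfun_lipschitz {I : Type} (D : I -> Prop) f B :
  polyfun D f -> 0 < B ->
  exists L, 0 < L /\ forall h z z',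
    (forall i, D i -> Cmod (z i) <= B) -> (forall i, D i -> Cmod (z' i) <= B) ->
    0 <= h -> (forall i, D i -> Cmod (z i - z' i) <= h) -> Cmod (f z - f z') <= L * h.
Proof.
  intros H HB. induction H as [c|j Hj|f g _ [K [HK IHf]] _ [L [HL IHg]]|f g Hf [K [HK IHf]] Hg [L [HL IHg]]].
  - exists 1. split; [lra|]. intros h z z' _ _ Hh _.
    replace (c - c)%C with (RtoC 0) by ring. rewrite Cmod_0. lra.
  - exists 1. split; [lra|]. intros h z z' _ _ Hh H. rewrite Rmult_1_l. auto.
  - exists (K + L). split; [lra|]. intros h z z' Hz Hz' Hh H.
    assert (H1 := IHf h z z' Hz Hz' Hh H). assert (H2 := IHg h z z' Hz Hz' Hh H).
    assert (H3 := Cmod_triangle (f z - f z') (g z - g z')).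
    replace (f z + g z - (f z' + g z'))%C with (f z - f z' + (g z - g z'))%C by ring. lra.
  - destruct (polyfun_bounded D f B Hf HB) as [F [HF BF]].
    destruct (polyfun_bounded D g B Hg HB) as [G [HG BG]].
    exists (K * G + F * L). split.
    { apply Rplus_lt_0_compat; apply Rmult_lt_0_compat; lra. }
    intros h z z' Hz Hz' Hh H.
    assert (H1 := IHf h z z' Hz Hz' Hh H). assert (H2 := IHg h z z' Hz Hz' Hh H).
    replace (f z * g z - f z' * g z')%C
      with ((f z - f z') * g z + f z' * (g z - g z'))%C by ring.
    eapply Rle_trans; [apply Cmod_triangle|]. rewrite !Cmod_mult.
    replace ((K * G + F * L) * h) with (K * h * G + F * (L * h)) by ring.
    apply Rplus_le_compat; apply Rmult_le_compat; auto using Cmod_ge_0.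
Qed.

(** * Zero sets of polynomials are null *)

Definition box (I : Type) : Type := ((I -> C) * (I -> C))%type.

Definition rsum (l : list R) : R := fold_right Rplus 0 l.

Lemma rsum_app l l' : rsum (l ++ l') = rsum l + rsum l'.
Proof. induction l as [|x l IH]; simpl; [lra | rewrite IH; lra]. Qed.

Lemma rsum_scal {A : Type} (f : A -> R) c l :
  rsum (map (fun x => f x * c) l) = rsum (map f l) * c.
Proof. induction l as [|x l IH]; simpl; [ring | rewrite IH; ring]. Qed.

Lemma rsum_list_prod {A B : Type} (f : A -> R) (g : B -> R) l l' :
  rsum (map (fun w => f (fst w) * g (snd w)) (list_prod l l')) = rsum (map f l) * rsum (map g l').
Proof.
  induction l as [|x l IH]; simpl; [ring|].
  rewrite map_app, rsum_app, IH, map_map. simpl.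
  rewrite Rmult_plus_distr_r, (Rmult_comm (f x)), <- (rsum_scal g (f x)).
  apply (f_equal2 Rplus); [|reflexivity]. f_equal. apply map_ext. intros. ring.
Qed.

Definition vol {I : Type} (dom : list I) (B : box I) : R := box_vol dom (fst B) (snd B).

Definition total_vol {I : Type} (dom : list I) (L : list (box I)) : R := rsum (map (vol dom) L).

Definition proper {I : Type} (dom : list I) (B : box I) : Prop :=
  forall i, In i dom -> fst (fst B i) <= fst (snd B i) /\ snd (fst B i) <= snd (snd B i).

Definition in_cube {I : Type} (dom : list I) (M : R) (z : I -> C) : Prop :=
  forall i, In i dom -> Rabs (fst (z i)) <= M /\ Rabs (snd (z i)) <= M.

Definition area (s : C * C) : R := (fst (snd s) - fst (fst s)) * (snd (snd s) - snd (fst s)).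

Definition areas (Q : list (C * C)) : R := rsum (map area Q).

Definition proper_sq (s : C * C) : Prop := fst (fst s) <= fst (snd s) /\ snd (fst s) <= snd (snd s).

Definition in_sq (s : C * C) (t : C) : Prop :=
  fst (fst s) <= fst t <= fst (snd s) /\ snd (fst s) <= snd t <= snd (snd s).

Definition ext_box {I : Type} (i : I) (B : box I) (s : C * C) : box I :=
  (upd (fst B) i (fst s), upd (snd B) i (snd s)).

Lemma box_vol_local {I : Type} (dom : list I) (a b a' b' : I -> C) :
  (forall i, In i dom -> a i = a' i /\ b i = b' i) -> box_vol dom a b = box_vol dom a' b'.
Proof.
  induction dom as [|i dom IH]; simpl; intros H; [reflexivity|].
  destruct (H i (or_introl eq_refl)) as [-> ->]. rewrite IH; auto.
Qed.

Lemma box_vol_nonneg {I : Type} (dom : list I) (B : box I) : proper dom B -> 0 <= vol dom B.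
Proof.
  unfold vol. induction dom as [|i dom IH]; simpl; intros H; [lra|].
  destruct (H i (or_introl eq_refl)).
  apply Rmult_le_pos; [apply Rmult_le_pos; lra|].
  apply IH. intros j Hj. apply H. now right.
Qed.

Lemma total_vol_app {I : Type} (dom : list I) L L' :
  total_vol dom (L ++ L') = total_vol dom L + total_vol dom L'.
Proof. unfold total_vol. now rewrite map_app, rsum_app. Qed.

Lemma vol_ext_box {I : Type} (i : I) dom B s :
  ~ In i dom -> vol (i :: dom) (ext_box i B s) = area s * vol dom B.
Proof.
  intros Hi. unfold vol, ext_box, area. simpl. rewrite !upd_same. f_equal.
  apply box_vol_local. intros j Hj.
  now rewrite !upd_other by (intros ->; contradiction).
Qed.

Lemma proper_ext_box {I : Type} (i : I) dom B s :
  proper dom B -> proper_sq s -> proper (i :: dom) (ext_box i B s).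
Proof.
  intros HB Hs j Hj. unfold ext_box, upd. simpl.
  destruct (excluded_middle_informative (j = i)); [exact Hs|].
  apply HB. destruct Hj; [congruence | assumption].
Qed.

Lemma in_ext_box {I : Type} (i : I) dom B s z :
  in_box dom (fst B) (snd B) z -> in_sq s (z i) ->
  in_box (i :: dom) (fst (ext_box i B s)) (snd (ext_box i B s)) z.
Proof.
  intros HB Hs j Hj. unfold ext_box, upd. simpl.
  destruct (excluded_middle_informative (j = i)) as [->|]; [exact Hs|].
  apply HB. destruct Hj; [congruence | assumption].
Qed.

Lemma total_vol_map_ext_box {I : Type} (i : I) dom B Q :
  ~ In i dom -> total_vol (i :: dom) (map (ext_box i B) Q) = areas Q * vol dom B.
Proof.
  intros Hi. unfold total_vol, areas. rewrite <- rsum_scal, map_map. f_equal.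
  apply map_ext. intros s. now apply vol_ext_box.
Qed.

(* [Rel B Q] says that the squares Q suffice in direction i above the box B. *)
Lemma refine_boxes {I : Type} (i : I) dom (kappa : R) (Rel : box I -> list (C * C) -> Prop) G :
  ~ In i dom ->
  (forall B, In B G -> proper dom B /\
     exists Q, (forall s, In s Q -> proper_sq s) /\ areas Q <= kappa /\ Rel B Q) ->
  exists L, (forall B, In B L -> proper (i :: dom) B) /\
    total_vol (i :: dom) L <= kappa * total_vol dom G /\
    forall B, In B G -> exists Q, Rel B Q /\ forall s, In s Q -> In (ext_box i B s) L.
Proof.
  intros Hi. induction G as [|B G IH]; intros H.
  - exists []. unfold total_vol. simpl. split; [easy|]. split; [lra | easy].
  - destruct IH as [L [HL1 [HL2 HL3]]]; [intros B' HB'; apply H; now right|].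
    destruct (H B (or_introl eq_refl)) as [HB [Q [HQ1 [HQ2 HQ3]]]].
    exists (map (ext_box i B) Q ++ L). split; [|split].
    + intros B' HB'. apply in_app_or in HB'. destruct HB' as [HB'|HB']; [|auto].
      apply in_map_iff in HB'. destruct HB' as [s [<- Hs]].
      apply proper_ext_box; auto.
    + rewrite total_vol_app, total_vol_map_ext_box by assumption.
      unfold total_vol at 2. simpl. fold (total_vol dom G).
      assert (areas Q * vol dom B <= kappa * vol dom B)
        by (apply Rmult_le_compat_r; [now apply box_vol_nonneg | assumption]).
      lra.
    + intros B' [<-|HB'].
      * exists Q. split; [assumption|]. intros s Hs. apply in_or_app. left. now apply in_map.
      * destruct (HL3 B' HB') as [Q' [H1 H2]]. exists Q'. split; [assumption|].
        intros s Hs. apply in_or_app. right. auto.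
Qed.

(** * Grids on intervals, squares and cubes *)

Lemma interval_grid h p : 0 < h -> forall a, exists l : list (R * R),
  (forall u, In u l -> fst u <= snd u <= fst u + h) /\
  rsum (map (fun u => snd u - fst u) l) = INR (S p) * h /\
  forall x, a <= x <= a + INR (S p) * h -> exists u, In u l /\ fst u <= x <= snd u.
Proof.
  intros Hh. induction p as [|p IH]; intros a.
  - exists [(a, a + h)]. simpl. split; [|split].
    + intros u [<-|[]]. simpl. lra.
    + lra.
    + intros x Hx. exists (a, a + h). simpl. split; [now left | lra].
  - destruct (IH (a + h)) as [l [H1 [H2 H3]]].
    exists ((a, a + h) :: l). split; [|split].
    + intros u [<-|Hu]; [simpl; lra | auto].
    + rewrite (S_INR (S p)). cbn [map rsum fold_right fst snd]. fold (rsum (map (fun u => snd u - fst u) l)).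
      rewrite H2. lra.
    + intros x Hx. rewrite (S_INR (S p)) in Hx.
      destruct (Rle_lt_dec x (a + h)).
      * exists (a, a + h). simpl. split; [now left | lra].
      * destruct (H3 x) as [u [Hu1 Hu2]]; [lra|]. exists u. split; [now right | assumption].
Qed.

Lemma square_grid M h : 0 < M -> 0 < h -> exists Q : list (C * C),
  (forall s, In s Q -> proper_sq s /\ fst (snd s) <= fst (fst s) + h /\ snd (snd s) <= snd (fst s) + h) /\
  areas Q = 4 * M * M /\
  forall t : C, Rabs (fst t) <= M -> Rabs (snd t) <= M -> exists s, In s Q /\ in_sq s t.
Proof.
  intros HM Hh. destruct (INR_unbounded (2 * M / h)) as [p Hp].
  assert (HSp : 0 < INR (S p)) by (apply lt_0_INR; lia).
  (* The mesh is shrunk from [h] to a divisor of the side [2 * M], so the cells fill the square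
     exactly and their areas add up to [4 * M * M]. *)
  set (k := 2 * M / INR (S p)).
  assert (Hk : 0 < k) by (apply Rdiv_lt_0_compat; lra).
  assert (Hkh : k <= h).
  { unfold k. apply Rmult_le_reg_r with (INR (S p)); [assumption|].
    unfold Rdiv. rewrite Rmult_assoc, Rinv_l, Rmult_1_r by lra.
    rewrite S_INR. apply Rmult_lt_compat_r with (r := h) in Hp; [|lra].
    unfold Rdiv in Hp. rewrite Rmult_assoc, Rinv_l, Rmult_1_r in Hp by lra. lra. }
  assert (HkM : INR (S p) * k = 2 * M) by (unfold k; field; lra).
  destruct (interval_grid k p Hk (- M)) as [l [H1 [H2 H3]]]. rewrite HkM in H2, H3.
  exists (map (fun w : (R * R) * (R * R) =>
             ((fst (fst w), fst (snd w)), (snd (fst w), snd (snd w)))) (list_prod l l)).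
  split; [|split].
  - intros s Hs. apply in_map_iff in Hs. destruct Hs as [[u v] [<- Huv]].
    apply in_prod_iff in Huv. destruct Huv as [Hu Hv].
    apply H1 in Hu. apply H1 in Hv. unfold proper_sq. simpl. lra.
  - unfold areas. rewrite map_map. unfold area. simpl.
    replace (4 * M * M) with (2 * M * (2 * M)) by ring. rewrite <- H2.
    apply rsum_list_prod with (f := fun u => snd u - fst u) (g := fun u => snd u - fst u).
  - intros t Ht1 Ht2. apply Rcomplements.Rabs_le_between in Ht1. apply Rcomplements.Rabs_le_between in Ht2.
    destruct (H3 (fst t)) as [u [Hu1 Hu2]]; [lra|].
    destruct (H3 (snd t)) as [v [Hv1 Hv2]]; [lra|].
    eexists. split.
    + apply in_map_iff. exists (u, v). split; [reflexivity|]. now apply in_prod.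
    + unfold in_sq. simpl. lra.
Qed.

(** The volume bound is free of the mesh [h]. The cover of sublevel sets relies on this, since it
    fixes the area allowed above each cell first and [h] afterwards. *)
Lemma cube_grid {I : Type} (dom : list I) M h : NoDup dom -> 0 < M -> 0 < h ->
  exists G : list (box I),
    (forall B, In B G -> proper dom B /\ forall i, In i dom ->
       fst (snd B i) <= fst (fst B i) + h /\ snd (snd B i) <= snd (fst B i) + h) /\
    total_vol dom G <= (4 * M * M) ^ length dom /\
    forall z, in_cube dom M z -> exists B, In B G /\ in_box dom (fst B) (snd B) z.
Proof.
  intros Hnd HM Hh. induction dom as [|i dom IH].
  - exists [(fun _ => RtoC 0, fun _ => RtoC 0)]. split; [|split].
    + intros B _. split; intros i [].
    + unfold total_vol, vol. simpl. lra.
    + intros z _. eexists. split; [now left | intros i []].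
  - inversion Hnd as [|? ? Hi Hnd']; subst.
    destruct (IH Hnd') as [G [HG1 [HG2 HG3]]].
    destruct (square_grid M h HM Hh) as [Q [HQ1 [HQ2 HQ3]]].
    exists (flat_map (fun B => map (ext_box i B) Q) G). split; [|split].
    + intros B HB. apply in_flat_map in HB. destruct HB as [B' [HB' HB]].
      apply in_map_iff in HB. destruct HB as [s [<- Hs]].
      destruct (HG1 B' HB') as [P1 P2]. destruct (HQ1 s Hs) as [P3 P4]. split.
      * now apply proper_ext_box.
      * intros j Hj. unfold ext_box, upd. simpl.
        destruct (excluded_middle_informative (j = i)); [assumption|].
        apply P2. destruct Hj; [congruence | assumption].
    + assert (E : total_vol (i :: dom) (flat_map (fun B => map (ext_box i B) Q) G)
                  = 4 * M * M * total_vol dom G).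
      { rewrite <- HQ2. clear HG1 HG2 HG3. induction G as [|B G IHG]; simpl.
        - unfold total_vol. simpl. ring.
        - rewrite total_vol_app, IHG, total_vol_map_ext_box by assumption.
          unfold total_vol. simpl. ring. }
      rewrite E. simpl. apply Rmult_le_compat_l; [|assumption].
      assert (0 < M * M) by now apply Rmult_lt_0_compat. lra.
    + intros z Hz. destruct (HG3 z) as [B [HB1 HB2]].
      { intros j Hj. apply Hz. now right. }
      destruct (Hz i (or_introl eq_refl)) as [Z1 Z2].
      destruct (HQ3 (z i) Z1 Z2) as [s [Hs1 Hs2]].
      exists (ext_box i B s). split.
      * apply in_flat_map. exists B. split; [assumption | now apply in_map].
      * now apply in_ext_box.
Qed.

(** * Covers of sublevel sets of polynomials *)

Lemma Cmod_le_2 (t : C) M : Rabs (fst t) <= M -> Rabs (snd t) <= M -> Cmod t <= 2 * M.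
Proof.
  intros H1 H2. eapply Rle_trans; [apply Cmod_2Rmax|].
  apply Rmult_le_compat; [apply sqrt_pos | | | now apply Rmax_lub].
  - eapply Rle_trans; [apply Rabs_pos | apply Rmax_l].
  - rewrite <- (sqrt_pow2 2) at 2 by lra. apply sqrt_le_1; lra.
Qed.

Lemma in_box_diff (a b t u h : R) : b <= a + h -> a <= t <= b -> a <= u <= b -> Rabs (t - u) <= h.
Proof. intros. apply Rabs_le. lra. Qed.

(** One [eps] serves all polynomials of degree at most [d] that exceed [delta] at [w]. This
    uniformity lets a single threshold work for all cells of a grid. *)
Lemma sublevel_squares d : forall M w delta kappa, 0 < M -> 0 < delta -> 0 < kappa ->
  exists eps, 0 < eps /\ forall p, deg_le d p -> delta < Cmod (p w) ->
    exists Q : list (C * C), (forall s, In s Q -> proper_sq s) /\ areas Q <= kappa /\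
      forall t, Rabs (fst t) <= M -> Rabs (snd t) <= M -> Cmod (p t) <= eps ->
        exists s, In s Q /\ in_sq s t.
Proof.
  intros M w delta kappa HM Hd Hk.
  assert (Hd1 : 0 < INR (S d)) by (apply lt_0_INR; lia).
  (* There will be at most [d] squares of side [2 * r]. As [r <= 1], each has area
     [4 * r * r <= 4 * r], and [S d] copies of [4 * r] stay within [kappa]; [S d] also avoids
     dividing by zero. *)
  set (r := Rmin 1 (kappa / (4 * INR (S d)))).
  assert (Hr : 0 < r) by (apply Rmin_glb_lt; [lra | apply Rdiv_lt_0_compat; lra]).
  assert (Hr1 : r <= 1) by apply Rmin_l.
  assert (Hr2 : INR (S d) * (4 * r) <= kappa).
  { assert (H := Rmin_r 1 (kappa / (4 * INR (S d)))). fold r in H.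
    apply Rmult_le_compat_l with (r := 4 * INR (S d)) in H; [|lra].
    replace (4 * INR (S d) * (kappa / (4 * INR (S d)))) with kappa in H by (field; lra). lra. }
  assert (HB : 0 < 2 * M + Cmod w) by (assert (H := Cmod_ge_0 w); lra).
  destruct (deg_le_sublevel d r delta _ Hr Hd HB) as [eps [He H]].
  exists eps. split; [assumption|]. intros p Hp Hpw.
  destruct (H p w Hp) as [l [Hl Hcov]]; [lra | assumption |].
  exists (map (fun x : C => ((fst x - r, snd x - r), (fst x + r, snd x + r))) l).
  split; [|split].
  - intros s Hs. apply in_map_iff in Hs. destruct Hs as [x [<- _]]. unfold proper_sq. simpl. lra.
  - apply Rle_trans with (INR (length l) * (4 * r)).
    + clear Hcov Hl. unfold areas. induction l as [|x l IH]; [simpl; lra|].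
      rewrite length_cons, S_INR. cbn [map rsum fold_right].
      fold (rsum (map area (map (fun x : C => ((fst x - r, snd x - r), (fst x + r, snd x + r))) l))).
      assert (area ((fst x - r, snd x - r), (fst x + r, snd x + r)) <= 4 * r).
      { unfold area. simpl.
        assert (r * r <= r * 1) by (apply Rmult_le_compat_l; lra). nra. }
      lra.
    + apply Rle_trans with (INR (S d) * (4 * r)); [|assumption].
      apply Rmult_le_compat_r; [lra|]. apply le_INR. lia.
  - intros t Ht1 Ht2 Hpt.
    destruct (Hcov t) as [x [Hx1 Hx2]]; [|assumption|].
    { assert (H1 := Cmod_le_2 t M Ht1 Ht2). assert (H2 := Cmod_ge_0 w). lra. }
    eexists. split; [apply in_map_iff; exists x; split; [reflexivity | assumption]|].
    assert (H1 := Rle_trans _ _ _ (Rmax_Cmod (t - x)%C) Hx2).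
    assert (H2 := Rle_trans _ _ _ (Rmax_l _ _) H1). assert (H3 := Rle_trans _ _ _ (Rmax_r _ _) H1).
    apply Rcomplements.Rabs_le_between in H2. apply Rcomplements.Rabs_le_between in H3.
    simpl in H2, H3. unfold in_sq. simpl. lra.
Qed.

(* Induction on the coordinates. Freezing coordinate i at w i gives a polynomial in fewer variables;
   where it is small the induction hypothesis gives a cover, and where it exceeds delta1 the
   polynomial in the single variable z i is small only on a set of small area, uniformly over the
   cells of a fine grid. *)
Lemma sublevel_cover {I : Type} (dom : list I) : NoDup dom ->
  forall M eps f w, 0 < M -> 0 < eps -> polyfun (fun i => In i dom) f -> f w <> 0 ->
  exists delta, 0 < delta /\ exists L : list (box I),
    (forall B, In B L -> proper dom B) /\ total_vol dom L <= eps /\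
    forall z, in_cube dom M z -> Cmod (f z) <= delta ->
      exists B, In B L /\ in_box dom (fst B) (snd B) z.
Proof.
  induction dom as [|i dom IH]; intros Hnd M eps f w HM Heps Hf Hw.
  - apply Cmod_gt_0 in Hw. exists (Cmod (f w) / 2). split; [lra|].
    exists []. split; [easy|]. split; [unfold total_vol; simpl; lra|].
    intros z _ Hz. rewrite (polyfun_local _ f Hf z w) in Hz by easy. lra.
  - inversion Hnd as [|? ? Hi Hnd']; subst.
    assert (HMM : 0 < 4 * M * M) by (assert (0 < M * M) by (apply Rmult_lt_0_compat; lra); lra).
    (* These boxes are later multiplied by the full square of area [4 * M * M] in direction [i],
       which turns the bound into [eps / 2]. *)
    destruct (IH Hnd' M (eps / 2 / (4 * M * M)) (fun z => f (upd z i (w i))) w HM)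
      as [delta1 [Hd1 [L1 [HL1 [HL1v HL1c]]]]].
    { apply Rdiv_lt_0_compat; lra. }
    { eapply polyfun_upd_const; [|exact Hf]. intros j [->|Hj] Hji; [contradiction | assumption]. }
    { rewrite (polyfun_local _ f Hf _ w); [assumption|].
      intros j _. unfold upd. destruct excluded_middle_informative; congruence. }
    set (V := (4 * M * M) ^ length dom).
    assert (HV : 0 < V) by (apply pow_lt; assumption).
    destruct (polyfun_line_deg _ f i Hf) as [d Hdeg].
    (* The cells of the grid have total volume at most [V], so area [eps / 2 / V] above each cell
       costs at most [eps / 2] altogether. *)
    destruct (sublevel_squares d M (w i) delta1 (eps / 2 / V) HM Hd1) as [e [He Hsq]].
    { apply Rdiv_lt_0_compat; lra. }
    destruct (polyfun_lipschitz _ f (2 * M) Hf) as [Lip [HLip Hlip]]; [lra|].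
    (* Two points of a cell differ by at most [h] in each real and imaginary part, hence by at most
       [2 * h] in modulus. So [f] varies by at most [e / 2], and [e / 2] at [z] becomes at most [e]
       at the representative. *)
    set (h := e / 2 / Lip / 2).
    assert (Hh : 0 < h) by (unfold h; repeat apply Rdiv_lt_0_compat; lra).
    assert (HLh : Lip * (2 * h) = e / 2) by (unfold h; field; lra).
    destruct (cube_grid dom M h Hnd' HM Hh) as [G [HG [HGv HGc]]]. fold V in HGv.
    set (Rel := fun (B : box I) (Q : list (C * C)) =>
      forall z, in_cube (i :: dom) M z -> in_box dom (fst B) (snd B) z ->
        Cmod (f z) <= e / 2 -> delta1 < Cmod (f (upd z i (w i))) ->
        exists s, In s Q /\ in_sq s (z i)).
    destruct (refine_boxes i dom (eps / 2 / V) Rel G Hi) as [L2 [HL2 [HL2v HL2c]]].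
    { intros B HB. destruct (HG B HB) as [HB1 HB2]. split; [assumption|].
      destruct (classic (exists c, in_cube (i :: dom) M c /\ in_box dom (fst B) (snd B) c /\
                          delta1 < Cmod (f (upd c i (w i))))) as [[c [Hc1 [Hc2 Hc3]]]|Hno].
      - destruct (Hsq (fun t => f (upd c i t)) (Hdeg c) Hc3) as [Q [HQ1 [HQ2 HQ3]]].
        exists Q. split; [assumption|]. split; [assumption|].
        intros z Hz1 Hz2 Hz3 _.
        destruct (Hz1 i (or_introl eq_refl)) as [Z1 Z2].
        apply HQ3; [assumption | assumption |].
        assert (H := Hlip (2 * h) (upd c i (z i)) z).
        assert (Cmod (f (upd c i (z i)) - f z) <= Lip * (2 * h)).
        { apply H.
          - intros j Hj. unfold upd. destruct excluded_middle_informative.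
            + now apply Cmod_le_2.
            + destruct (Hc1 j Hj). now apply Cmod_le_2.
          - intros j Hj. destruct (Hz1 j Hj). now apply Cmod_le_2.
          - lra.
          - intros j Hj. unfold upd. destruct excluded_middle_informative as [->|Hji].
            + replace (z i - z i)%C with (RtoC 0) by ring. rewrite Cmod_0. lra.
            + assert (Hj' : In j dom) by (destruct Hj; [congruence | assumption]).
              destruct (HB2 j Hj') as [B1 B2]. destruct (Hc2 j Hj') as [C1 C2].
              destruct (Hz2 j Hj') as [C3 C4].
              apply Cmod_le_2; [exact (in_box_diff _ _ _ _ _ B1 C1 C3) | exact (in_box_diff _ _ _ _ _ B2 C2 C4)]. }
        assert (H2 := Cmod_minus_ge (f (upd c i (z i))) (f z)). lra.
      - exists []. split; [easy|]. split.
        + unfold areas. simpl. apply Rlt_le, Rdiv_lt_0_compat; lra.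
        + intros z Hz1 Hz2 _ Hz4. destruct Hno. now exists z. }
    exists (e / 2). split; [lra|].
    set (s0 := (((- M, - M) : C), ((M, M) : C))).
    exists (map (fun B => ext_box i B s0) L1 ++ L2). split; [|split].
    + intros B HB. apply in_app_or in HB. destruct HB as [HB|HB]; [|auto].
      apply in_map_iff in HB. destruct HB as [B' [<- HB']].
      apply proper_ext_box; [auto|]. unfold proper_sq, s0. simpl. lra.
    + rewrite total_vol_app.
      assert (E : total_vol (i :: dom) (map (fun B => ext_box i B s0) L1)
                  = 4 * M * M * total_vol dom L1).
      { unfold total_vol. rewrite map_map, Rmult_comm, <- rsum_scal. f_equal.
        apply map_ext. intros B. rewrite vol_ext_box by assumption.
        unfold area, s0. simpl. ring. }
      rewrite E.
      apply Rmult_le_compat_l with (r := 4 * M * M) in HL1v; [|lra].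
      replace (4 * M * M * (eps / 2 / (4 * M * M))) with (eps / 2) in HL1v by (field; lra).
      assert (eps / 2 / V * total_vol dom G <= eps / 2 / V * V).
      { apply Rmult_le_compat_l; [apply Rlt_le, Rdiv_lt_0_compat; lra | assumption]. }
      replace (eps / 2 / V * V) with (eps / 2) in H by (field; lra). lra.
    + intros z Hz Hfz.
      assert (Hz' : in_cube dom M z) by (intros j Hj; apply Hz; now right).
      destruct (Hz i (or_introl eq_refl)) as [Z1 Z2].
      destruct (Rle_lt_dec (Cmod (f (upd z i (w i)))) delta1) as [Hle|Hlt].
      * destruct (HL1c z Hz' Hle) as [B [HB1 HB2]].
        exists (ext_box i B s0). split; [apply in_or_app; left; now apply in_map with (f := fun B => ext_box i B s0)|].
        apply in_ext_box; [assumption|].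
        apply Rcomplements.Rabs_le_between in Z1. apply Rcomplements.Rabs_le_between in Z2.
        unfold in_sq, s0. simpl. lra.
      * destruct (HGc z Hz') as [B [HB1 HB2]].
        destruct (HL2c B HB1) as [Q [HQ1 HQ2]].
        destruct (HQ1 z Hz HB2 Hfz Hlt) as [s [Hs1 Hs2]].
        exists (ext_box i B s). split; [apply in_or_app; right; auto | now apply in_ext_box].
Qed.

(** Finite covers of the part in each cube are stable under finite unions with no bookkeeping of
    sequences. The passage to one countable cover of the whole set is made only once. *)
Definition locally_negligible {I : Type} (dom : list I) (E : (I -> C) -> Prop) : Prop :=
  forall M eps, 0 < M -> 0 < eps -> exists L : list (box I),
    (forall B, In B L -> proper dom B) /\ total_vol dom L <= eps /\
    forall z, E z -> in_cube dom M z -> exists B, In B L /\ in_box dom (fst B) (snd B) z.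

Lemma polyfun_zero_negligible {I : Type} (dom : list I) f w :
  NoDup dom -> polyfun (fun i => In i dom) f -> f w <> 0 ->
  locally_negligible dom (fun z => f z = 0).
Proof.
  intros Hnd Hf Hw M eps HM He.
  destruct (sublevel_cover dom Hnd M eps f w HM He Hf Hw) as [delta [Hd [L [H1 [H2 H3]]]]].
  exists L. split; [assumption|]. split; [assumption|].
  intros z Hz Hc. apply H3; [assumption|]. rewrite Hz, Cmod_0. lra.
Qed.

Lemma locally_negligible_union {I T : Type} (dom : list I) (l : list T) (E : T -> (I -> C) -> Prop) :
  (forall t, In t l -> locally_negligible dom (E t)) ->
  locally_negligible dom (fun z => exists t, In t l /\ E t z).
Proof.
  induction l as [|t l IH]; intros H M eps HM He.
  - exists []. split; [easy|]. split; [unfold total_vol; simpl; lra|]. intros z [t [[] _]].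
  - destruct (H t (or_introl eq_refl) M (eps / 2) HM) as [L1 [A1 [A2 A3]]]; [lra|].
    destruct (IH (fun u Hu => H u (or_intror Hu)) M (eps / 2) HM) as [L2 [B1 [B2 B3]]]; [lra|].
    exists (L1 ++ L2). split; [|split].
    + intros B HB. apply in_app_or in HB. destruct HB; auto.
    + rewrite total_vol_app. lra.
    + intros z [u [[<-|Hu] HE]] Hz.
      * destruct (A3 z HE Hz) as [B [HB1 HB2]]. exists B. split; [apply in_or_app; now left | assumption].
      * destruct (B3 z (ex_intro _ u (conj Hu HE)) Hz) as [B [HB1 HB2]].
        exists B. split; [apply in_or_app; now right | assumption].
Qed.

(** * From finite covers on growing cubes to one sequence of boxes *)

Fixpoint concat_upto {T : Type} (L : nat -> list T) (k : nat) : list T :=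
  match k with
  | O => L O
  | S k' => concat_upto L k' ++ L (S k')
  end.

Lemma concat_upto_prefix {T : Type} (L : nat -> list T) k k' :
  (k <= k')%nat -> exists r, concat_upto L k' = concat_upto L k ++ r.
Proof.
  induction 1 as [|k' _ [r IH]].
  - exists []. now rewrite app_nil_r.
  - exists (r ++ L (S k')). simpl. now rewrite IH, app_assoc.
Qed.

Lemma concat_upto_length {T : Type} (L : nat -> list T) k :
  (forall j, (0 < length (L j))%nat) -> (k < length (concat_upto L k))%nat.
Proof.
  intros H. induction k as [|k IH]; simpl; [apply H|].
  rewrite length_app. specialize (H (S k)). lia.
Qed.

Lemma nth_concat_upto {T : Type} (L : nat -> list T) d j k :
  (forall i, (0 < length (L i))%nat) -> (j < length (concat_upto L k))%nat ->
  nth j (concat_upto L j) d = nth j (concat_upto L k) d.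
Proof.
  intros HL Hj. assert (Hjj := concat_upto_length L j HL).
  destruct (Nat.le_ge_cases j k) as [H|H];
    destruct (concat_upto_prefix L _ _ H) as [r ->]; now rewrite app_nth1.
Qed.

Lemma in_concat_upto {T : Type} (L : nat -> list T) k x :
  In x (concat_upto L k) -> exists j, In x (L j).
Proof.
  induction k as [|k IH]; simpl; intros H; [now exists O|].
  apply in_app_or in H. destruct H; [auto | now exists (S k)].
Qed.

Lemma sum_nth_le {T : Type} (g : T -> R) d l : (forall x, In x l -> 0 <= g x) ->
  forall K, (K < length l)%nat -> sum_f_R0 (fun k => g (nth k l d)) K <= rsum (map g l).
Proof.
  induction l as [|x l IH]; intros H K HK; simpl in HK; [lia|].
  assert (Hx : 0 <= g x) by (apply H; now left).
  assert (H' : forall y, In y l -> 0 <= g y) by (intros y Hy; apply H; now right).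
  assert (Hl : 0 <= rsum (map g l)).
  { clear -H'. induction l as [|y l IH]; simpl; [lra|].
    assert (0 <= g y) by (apply H'; now left).
    assert (0 <= rsum (map g l)) by (apply IH; intros; apply H'; now right). lra. }
  destruct K as [|K]; [simpl; lra|].
  rewrite decomp_sum by lia. simpl. apply Rplus_le_compat_l, IH; [assumption | lia].
Qed.

(** The cubes with bounds 1, 2, 3, ... exhaust the space; the cover on the one numbered [k] from
    zero gets volume [eps / 2^(k+1)], and all covers are strung into one sequence. For an empty
    [dom] every box has volume 1, so [dom <> []] is required. *)
Lemma locally_negligible_null {I : Type} (dom : list I) E :
  dom <> [] -> locally_negligible dom E -> null_set dom E.
Proof.
  intros Hdom H eps He.
  assert (Hk : forall k, 0 < INR (S k)) by (intros k; apply lt_0_INR; lia).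
  assert (Hek : forall k, 0 < eps * (/ 2) ^ S k).
  { intros k. apply Rmult_lt_0_compat; [lra|]. apply pow_lt. lra. }
  set (L k := proj1_sig (constructive_indefinite_description _ (H _ _ (Hk k) (Hek k)))).
  assert (HL : forall k, (forall B, In B (L k) -> proper dom B) /\
     total_vol dom (L k) <= eps * (/ 2) ^ S k /\
     forall z, E z -> in_cube dom (INR (S k)) z ->
       exists B, In B (L k) /\ in_box dom (fst B) (snd B) z).
  { intros k. exact (proj2_sig (constructive_indefinite_description _ (H _ _ (Hk k) (Hek k)))). }
  clearbody L.
  (* padding by a box of volume 0, so that every list is nonempty *)
  set (d := ((fun _ => RtoC 0), (fun _ => RtoC 0)) : box I).
  assert (Hd : proper dom d) by (intros i _; simpl; lra).
  assert (Hdv : vol dom d = 0).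
  { unfold vol. destruct dom as [|i dom]; [contradiction|]. simpl. ring. }
  set (L' k := d :: L k).
  assert (HL'0 : forall k, (0 < length (L' k))%nat) by (intros; simpl; lia).
  (* Every list is nonempty, so the first [k + 1] lists together already have more than [k] entries
     and later lists do not change entry [k]. *)
  set (q k := nth k (concat_upto L' k) d).
  assert (Hprop : forall k B, In B (concat_upto L' k) -> proper dom B).
  { intros k B HB. apply in_concat_upto in HB. destruct HB as [j [<-|HB]]; [assumption|].
    now apply (proj1 (HL j)). }
  exists (fun k => fst (q k)), (fun k => snd (q k)). split; [|split].
  - intros k i Hi. apply (Hprop k (q k)); [|assumption].
    apply nth_In, concat_upto_length, HL'0.
  - intros K. apply Rle_trans with (total_vol dom (concat_upto L' K)).
    + rewrite (sum_eq _ (fun k => vol dom (nth k (concat_upto L' K) d))).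
      * apply sum_nth_le.
        -- intros B HB. apply box_vol_nonneg. eauto.
        -- apply concat_upto_length, HL'0.
      * intros j Hj. fold (vol dom (q j)). f_equal. apply nth_concat_upto; [assumption|].
        assert (H1 := concat_upto_length L' K HL'0). lia.
    + assert (HT : forall k, total_vol dom (L' k) <= eps * (/ 2) ^ S k).
      { intros k. unfold L', total_vol. cbn [map rsum fold_right]. rewrite Hdv.
        destruct (HL k) as [_ [H1 _]]. unfold total_vol, rsum in H1. lra. }
      (* The exact value of the geometric sum is needed for the induction to go through; the bound
         [eps] alone is not inductive. *)
      assert (H0 : total_vol dom (concat_upto L' K) <= eps * (1 - (/ 2) ^ S K)).
      { induction K as [|K IH].
        - cbn [concat_upto]. specialize (HT O). simpl in *. lra.
        - cbn [concat_upto]. rewrite total_vol_app. specialize (HT (S K)). simpl in *. lra. }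
      assert (0 < (/ 2) ^ S K) by (apply pow_lt; lra). nra.
  - intros z Hz.
    assert (Hbd : exists M, in_cube dom M z).
    { clear -dom. induction dom as [|i dom [M IH]]; [exists 0; intros i []|].
      exists (Rmax M (Rmax (Rabs (fst (z i))) (Rabs (snd (z i))))).
      intros j [<-|Hj].
      - split; (eapply Rle_trans; [|apply Rmax_r]); [apply Rmax_l | apply Rmax_r].
      - destruct (IH j Hj). split; (eapply Rle_trans; [|apply Rmax_l]); assumption. }
    destruct Hbd as [M HM]. destruct (INR_unbounded M) as [k Hkk].
    destruct (HL k) as [_ [_ Hc]]. destruct (Hc z Hz) as [B [HB1 HB2]].
    { intros i Hi. destruct (HM i Hi). rewrite S_INR. lra. }
    assert (HB : In B (concat_upto L' k)).
    { destruct k; [now right|]. simpl. apply in_or_app. right. now right. }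
    apply In_nth with (d := d) in HB. destruct HB as [j [Hj1 Hj2]].
    exists j. unfold q. rewrite (nth_concat_upto L' d j k HL'0 Hj1), Hj2. assumption.
Qed.

(** * Generic injectivity of linear systems with polynomial coefficients *)

Definition lsum {U : Type} (l : list U) (f : U -> C) : C :=
  fold_right (fun u acc => f u + acc)%C (RtoC 0) l.

Lemma lsum_ext {U : Type} (l : list U) (f g : U -> C) :
  (forall u, In u l -> f u = g u) -> lsum l f = lsum l g.
Proof.
  induction l as [|u l IH]; simpl; intros H; [reflexivity|].
  rewrite H, IH; auto.
Qed.

Lemma lsum_add {U : Type} (l : list U) (f g : U -> C) :
  lsum l (fun u => f u + g u)%C = (lsum l f + lsum l g)%C.
Proof. induction l as [|u l IH]; simpl; [ring | rewrite IH; ring]. Qed.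

Lemma lsum_scal {U : Type} (l : list U) (a : C) (f : U -> C) :
  lsum l (fun u => a * f u)%C = (a * lsum l f)%C.
Proof. induction l as [|u l IH]; simpl; [ring | rewrite IH; ring]. Qed.

Lemma lsum_zero {U : Type} (l : list U) (f : U -> C) : (forall u, In u l -> f u = 0) -> lsum l f = 0.
Proof.
  intros H. induction l as [|u l IH]; simpl; [reflexivity|].
  rewrite (H u (or_introl eq_refl)), IH by (intros; apply H; now right). ring.
Qed.

Lemma lsum_single {U : Type} (l : list U) (f : U -> C) u : NoDup l -> In u l ->
  (forall u', In u' l -> u' <> u -> f u' = 0) -> lsum l f = f u.
Proof.
  intros Hnd. induction Hnd as [|x l Hx Hnd IH]; simpl; intros Hu H; [contradiction|].
  destruct Hu as [->|Hu].
  - rewrite lsum_zero; [ring|]. intros y Hy. apply H; [now right | congruence].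
  - rewrite IH, (H x); [ring | now left | congruence | assumption |].
    intros y Hy. apply H. now right.
Qed.

Lemma lsum_app {U : Type} (l l' : list U) (f : U -> C) : lsum (l ++ l') f = (lsum l f + lsum l' f)%C.
Proof. induction l as [|u l IH]; simpl; [ring | rewrite IH; ring]. Qed.

Lemma lsum_map {U V : Type} (h : U -> V) (l : list U) (f : V -> C) :
  lsum (map h l) f = lsum l (fun u => f (h u)).
Proof. induction l as [|u l IH]; simpl; [reflexivity | now rewrite IH]. Qed.

Lemma lsum_perm {U : Type} (l l' : list U) (f : U -> C) : Permutation l l' -> lsum l f = lsum l' f.
Proof. induction 1; simpl; [reflexivity | congruence | ring | congruence]. Qed.

Lemma lsum_swap {U V : Type} (l : list U) (l' : list V) (f : U -> V -> C) :
  lsum l (fun u => lsum l' (f u)) = lsum l' (fun v => lsum l (fun u => f u v)).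
Proof.
  induction l as [|u l IH]; simpl; [symmetry; now apply lsum_zero|].
  rewrite IH. symmetry. apply (lsum_add l' (f u)).
Qed.

Lemma Csum_lsum n f : (Csum n f : C) = lsum (seq 0 n) f.
Proof.
  induction n as [|n IH]; [reflexivity|].
  rewrite seq_S, lsum_app, <- IH. simpl.
  change (Cadd (Csum n f) (f n)) with (Csum n f + f n)%C. ring.
Qed.

Lemma lsum_restrict m (K : list nat) (f : nat -> C) : NoDup K ->
  (forall k, In k K -> (k < m)%nat) -> (forall k, (k < m)%nat -> ~ In k K -> f k = 0) ->
  lsum (seq 0 m) f = lsum K f.
Proof.
  intros Hnd HK Hf.
  set (rest := filter (fun k => if in_dec Nat.eq_dec k K then false else true) (seq 0 m)).
  assert (Hrest : forall k, In k rest <-> (k < m)%nat /\ ~ In k K).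
  { intros k. unfold rest. rewrite filter_In, in_seq. destruct in_dec; intuition (easy || lia). }
  rewrite (lsum_perm _ (K ++ rest)), lsum_app, (lsum_zero rest f).
  - ring.
  - intros k Hk. apply Hrest in Hk. now apply Hf.
  - apply NoDup_Permutation; [apply seq_NoDup | |].
    + apply NoDup_app; [assumption | apply NoDup_filter, seq_NoDup |].
      intros k Hk Hk'. now apply Hrest in Hk'.
    + intros k. rewrite in_app_iff, Hrest, in_seq. specialize (HK k).
      destruct (in_dec Nat.eq_dec k K); intuition lia.
Qed.

Lemma list_nth_seq {T : Type} (l : list T) d : l = map (fun k => nth k l d) (seq 0 (length l)).
Proof.
  induction l as [|x l IH]; simpl; [reflexivity|].
  rewrite <- seq_shift, map_map. now f_equal.
Qed.

Lemma lsum_nth (K : list nat) (f : nat -> C) :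
  lsum K f = lsum (seq 0 (length K)) (fun k => f (nth k K O)).
Proof. rewrite (list_nth_seq K O) at 1. apply lsum_map. Qed.

Lemma polyfun_opp {I : Type} (D : I -> Prop) f : polyfun D f -> polyfun D (fun z => - f z)%C.
Proof.
  intros H. assert (H1 := pf_mul D _ _ (pf_const D (- RtoC 1)%C) H).
  replace (fun z => - f z)%C with (fun z => - RtoC 1 * f z)%C; [assumption|].
  apply FunctionalExtensionality.functional_extensionality. intros z. ring.
Qed.

Lemma polyfun_lsum {I U : Type} (D : I -> Prop) (l : list U) (f : U -> (I -> C) -> C) :
  (forall u, In u l -> polyfun D (f u)) -> polyfun D (fun z => lsum l (fun u => f u z)).
Proof.
  induction l as [|u l IH]; simpl; intros H.
  - apply pf_const.
  - apply (pf_add D (f u)); auto.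
Qed.

(** Gaussian elimination without division, with pivots chosen at the point [w]. [F] is the product
    of the successive pivots, so elimination succeeds wherever [F] does not vanish. The rows may
    form any type, as only one pivot row per column is selected. *)
Lemma matrix_injective_generic {I U Row : Type} (D : I -> Prop) (cols : list U) : NoDup cols ->
  forall (M : Row -> U -> (I -> C) -> C) (w : I -> C),
  (forall r c, polyfun D (M r c)) ->
  (forall v : U -> C, (forall r, lsum cols (fun c => M r c w * v c)%C = 0) ->
     forall c, In c cols -> v c = 0) ->
  exists F, polyfun D F /\ F w <> 0 /\
    forall z, F z <> 0 -> forall v : U -> C,
      (forall r, lsum cols (fun c => M r c z * v c)%C = 0) -> forall c, In c cols -> v c = 0.
Proof.
  induction 1 as [|c cols Hc Hnd IH]; intros M w HM Hw.
  - exists (fun _ => RtoC 1). split; [apply pf_const|]. split; [apply C1_nz|]. intros z _ v _ c [].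
  - assert (Hpiv : exists r0, M r0 c w <> 0).
    { apply NNPP. intros Hno. apply C1_nz.
      rewrite <- (upd_same (fun _ => RtoC 0) c (RtoC 1)).
      apply Hw; [|now left]. intros r. simpl. rewrite upd_same.
      replace (M r c w) with (RtoC 0).
      - rewrite lsum_zero; [ring|]. intros u Hu. rewrite upd_other by congruence. ring.
      - destruct (Ceq_dec (M r c w) 0); [congruence|]. destruct Hno. now exists r. }
    destruct Hpiv as [r0 Hr0].
    (* Cross-multiplying with the pivot row cancels column [c] and keeps the entries polynomial. *)
    set (M' := fun r u z => (M r0 c z * M r u z + - (M r c z * M r0 u z))%C).
    assert (HM' : forall r z v,
      lsum cols (fun u => M' r u z * v u)%C
      = (M r0 c z * lsum cols (fun u => M r u z * v u)%C
         - M r c z * lsum cols (fun u => M r0 u z * v u)%C)%C).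
    { intros r z v. unfold Cminus. rewrite <- lsum_scal.
      replace (- (M r c z * lsum cols (fun u => M r0 u z * v u)))%C
        with ((- M r c z) * lsum cols (fun u => M r0 u z * v u))%C by ring.
      rewrite <- lsum_scal, <- lsum_add. apply lsum_ext. intros u _. unfold M'. ring. }
    destruct (IH M' w) as [F [HF1 [HF2 HF3]]].
    { intros r u. apply pf_add; [apply pf_mul | apply polyfun_opp, pf_mul]; apply HM. }
    { intros v Hv u Hu.
      (* The value at [c] that solves the pivot row, lifting a kernel vector of the reduced matrix
         to one of [M]. *)
      set (x := (- lsum cols (fun u => M r0 u w * v u)%C / M r0 c w)%C).
      assert (Hx : forall r, lsum cols (fun u => M r u w * upd v c x u)%C
                             = lsum cols (fun u => M r u w * v u)%C).
      { intros r. apply lsum_ext. intros u' Hu'. rewrite upd_other; [reflexivity | congruence]. }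
      rewrite <- (upd_other v c u x) by congruence.
      apply Hw; [|now right]. intros r. simpl. rewrite upd_same, Hx.
      specialize (Hv r). rewrite HM' in Hv.
      apply Ceq_minus in Hv.
      replace (lsum cols (fun u => M r u w * v u)%C)
        with (M r c w * lsum cols (fun u => M r0 u w * v u)%C / M r0 c w)%C
        by (rewrite <- Hv; now field).
      unfold x. now field. }
    exists (fun z => M r0 c z * F z)%C. split; [now apply pf_mul|].
    split; [now apply Cmult_neq_0|].
    intros z Hz v Hv.
    assert (Hz1 : M r0 c z <> 0) by (intros E; apply Hz; rewrite E; ring).
    assert (Hz2 : F z <> 0) by (intros E; apply Hz; rewrite E; ring).
    simpl in Hv.
    assert (Hv' : forall u, In u cols -> v u = 0).
    { apply (HF3 z Hz2). intros r. rewrite HM'.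
      assert (E1 := Hv r). assert (E2 := Hv r0).
      replace (lsum cols (fun u => M r u z * v u)%C) with (- (M r c z * v c))%C
        by (rewrite <- (Cplus_0_r (- _)), <- E1; ring).
      replace (lsum cols (fun u => M r0 u z * v u)%C) with (- (M r0 c z * v c))%C
        by (rewrite <- (Cplus_0_r (- _)), <- E2; ring).
      ring. }
    intros u [<-|Hu]; [|auto].
    specialize (Hv r0). rewrite lsum_zero, Cplus_0_r in Hv.
    + destruct (Ceq_dec (v c) 0) as [|Hvc]; [assumption|].
      now destruct (Cmult_neq_0 _ _ Hz1 Hvc).
    + intros u Hu. rewrite Hv' by assumption. ring.
Qed.

(** The coefficients are only asserted to exist, so an equation can be written as an expression in
    the unknowns and recognised as linear by closure rules. *)
Definition linform {I U : Type} (D : I -> Prop) (cols : list U) (g : (I -> C) -> (U -> C) -> C) : Prop :=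
  exists M : U -> (I -> C) -> C, (forall c, polyfun D (M c)) /\
    forall z v, g z v = lsum cols (fun c => M c z * v c)%C.

Lemma linform_var {I U : Type} (D : I -> Prop) (cols : list U) c :
  NoDup cols -> In c cols -> linform D cols (fun (_ : I -> C) v => v c).
Proof.
  intros Hnd Hc.
  exists (fun c' _ => if excluded_middle_informative (c' = c) then RtoC 1 else RtoC 0). split.
  - intros c'. destruct excluded_middle_informative; apply pf_const.
  - intros z v. rewrite (lsum_single cols _ c Hnd Hc).
    + destruct excluded_middle_informative; [ring | congruence].
    + intros c' _ Hc'. destruct excluded_middle_informative; [congruence | ring].
Qed.

Lemma linform_scal {I U : Type} (D : I -> Prop) (cols : list U) f g :
  polyfun D f -> linform D cols g -> linform D cols (fun (z : I -> C) v => f z * g z v)%C.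
Proof.
  intros Hf [M [HM E]]. exists (fun c z => f z * M c z)%C. split.
  - intros c. now apply pf_mul.
  - intros z v. rewrite E, <- lsum_scal. apply lsum_ext. intros; ring.
Qed.

Lemma linform_add {I U : Type} (D : I -> Prop) (cols : list U) g h :
  linform D cols g -> linform D cols h -> linform D cols (fun (z : I -> C) v => g z v + h z v)%C.
Proof.
  intros [M [HM E]] [N [HN E']]. exists (fun c z => M c z + N c z)%C. split.
  - intros c. now apply pf_add.
  - intros z v. rewrite E, E', <- lsum_add. apply lsum_ext. intros; ring.
Qed.

Lemma linform_zero {I U : Type} (D : I -> Prop) (cols : list U) :
  linform D cols (fun (_ : I -> C) _ => RtoC 0).
Proof.
  exists (fun _ _ => RtoC 0). split; [intros; apply pf_const|].
  intros z v. symmetry. apply lsum_zero. intros; ring.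
Qed.

Lemma linform_lsum {I U V : Type} (D : I -> Prop) (cols : list U) (l : list V) g :
  (forall x, In x l -> linform D cols (g x)) ->
  linform D cols (fun (z : I -> C) v => lsum l (fun x => g x z v)).
Proof.
  induction l as [|x l IH]; simpl; intros H.
  - apply linform_zero.
  - apply (linform_add D cols (g x)); auto.
Qed.

Lemma linform_injective_generic {I U Row : Type} (D : I -> Prop) (cols : list U)
    (g : Row -> (I -> C) -> (U -> C) -> C) (w : I -> C) : NoDup cols ->
  (forall r, linform D cols (g r)) ->
  (forall v, (forall r, g r w v = 0) -> forall c, In c cols -> v c = 0) ->
  exists F, polyfun D F /\ F w <> 0 /\
    forall z, F z <> 0 -> forall v, (forall r, g r z v = 0) -> forall c, In c cols -> v c = 0.
Proof.
  intros Hnd Hg Hw.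
  set (M r := proj1_sig (constructive_indefinite_description _ (Hg r))).
  assert (HM : forall r, (forall c, polyfun D (M r c)) /\
    forall z v, g r z v = lsum cols (fun c => M r c z * v c)%C).
  { intros r. exact (proj2_sig (constructive_indefinite_description _ (Hg r))). }
  clearbody M.
  destruct (matrix_injective_generic D cols Hnd M w) as [F [HF1 [HF2 HF3]]].
  - intros r. apply HM.
  - intros v Hv. apply Hw. intros r. now rewrite (proj2 (HM r)).
  - exists F. split; [assumption|]. split; [assumption|]. intros z Hz v Hv.
    apply (HF3 z Hz). intros r. now rewrite <- (proj2 (HM r)).
Qed.

(** * The Fourier example *)

Definition omega (n : nat) : C := (cos (2 * PI / INR n), sin (2 * PI / INR n)).

Lemma omega_pow n k :
  (omega n ^ k)%C = (cos (INR k * (2 * PI / INR n)), sin (INR k * (2 * PI / INR n))).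
Proof.
  induction k as [|k IH].
  - simpl. now rewrite Rmult_0_l, cos_0, sin_0.
  - rewrite Cpow_S, IH, S_INR, Rmult_plus_distr_r, Rmult_1_l, cos_plus, sin_plus.
    unfold omega, Cmult. simpl. f_equal; ring.
Qed.

Lemma omega_pow_n n : (0 < n)%nat -> (omega n ^ n)%C = 1.
Proof.
  intros Hn. rewrite omega_pow.
  replace (INR n * (2 * PI / INR n)) with (2 * PI) by (field; apply not_0_INR; lia).
  now rewrite cos_2PI, sin_2PI.
Qed.

Lemma omega_pow_neq_1 n k : (0 < k < n)%nat -> (omega n ^ k)%C <> 1.
Proof.
  intros Hk E. rewrite omega_pow in E. apply (f_equal fst) in E. simpl in E.
  assert (Hn : 0 < INR n) by (apply lt_0_INR; lia).
  assert (Hk0 : 0 < INR k) by (apply lt_0_INR; lia).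
  assert (Hkn : INR k < INR n) by (apply lt_INR; lia).
  assert (HPI := PI_RGT_0).
  set (x := INR k / INR n * PI).
  replace (INR k * (2 * PI / INR n)) with (2 * x) in E by (unfold x; field; lra).
  rewrite cos_2a_sin in E.
  assert (0 < sin x); [|nra].
  assert (H0 : 0 < INR k / INR n) by (apply Rdiv_lt_0_compat; lra).
  assert (H1 : INR k / INR n < 1).
  { apply Rmult_lt_reg_r with (INR n); [assumption|].
    unfold Rdiv. rewrite Rmult_assoc, Rinv_l; lra. }
  apply sin_gt_0; unfold x; nra.
Qed.

Lemma geometric_sum (x : C) n :
  ((x - 1) * lsum (seq 0 n) (fun i => x ^ i))%C = (x ^ n - 1)%C.
Proof.
  induction n as [|n IH].
  - simpl. ring.
  - rewrite seq_S, lsum_app, Cmult_plus_distr_l, IH, Cpow_S. simpl. ring.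
Qed.

Lemma omega_sum_0 n k : (0 < n)%nat -> (k mod n <> 0)%nat ->
  lsum (seq 0 n) (fun i => omega n ^ (i * k))%C = 0.
Proof.
  intros Hn Hk.
  assert (Hm := Nat.mod_upper_bound k n ltac:(lia)).
  assert (E : (omega n ^ k = omega n ^ (k mod n))%C).
  { rewrite (Nat.div_mod k n) at 1 by lia.
    rewrite Cpow_add_r, Cpow_mult_r, omega_pow_n, Cpow_1_l by assumption. ring. }
  rewrite (lsum_ext _ _ (fun i => (omega n ^ k) ^ i)%C).
  2:{ intros i _. now rewrite <- Cpow_mult_r, Nat.mul_comm. }
  assert (H := geometric_sum (omega n ^ k) n).
  rewrite <- Cpow_mult_r, Nat.mul_comm, Cpow_mult_r, omega_pow_n, Cpow_1_l in H by assumption.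
  replace (1 - 1)%C with (RtoC 0) in H by ring.
  destruct (Ceq_dec (lsum (seq 0 n) (fun i => (omega n ^ k) ^ i)%C) 0) as [|Hs]; [assumption|].
  exfalso. revert H. apply Cmult_neq_0; [|assumption].
  rewrite E. intros H. apply (omega_pow_neq_1 n (k mod n)); [lia|]. now apply Ceq_minus.
Qed.

Lemma lsum_const_1 n : lsum (seq 0 n) (fun _ => RtoC 1) = RtoC (INR n).
Proof.
  induction n as [|n IH]; [reflexivity|].
  rewrite seq_S, lsum_app, IH, S_INR, RtoC_plus. simpl. ring.
Qed.

Lemma omega_sum_n n k : (0 < n)%nat -> (k mod n = 0)%nat ->
  lsum (seq 0 n) (fun i => omega n ^ (i * k))%C = RtoC (INR n).
Proof.
  intros Hn Hk. rewrite <- lsum_const_1. apply lsum_ext. intros i _.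
  apply Nat.Div0.div_exact in Hk.
  rewrite Hk, Nat.mul_comm, <- Nat.mul_assoc, Cpow_mult_r, omega_pow_n by assumption.
  apply Cpow_1_l.
Qed.

(** With natural exponents, [n - b] plays the part of [- b] modulo [n]. The sum lies strictly
    between 0 and [2 * n], so the only multiple of [n] it can equal is [n]. *)
Lemma mod_shift_eq_0 n a b : (1 <= a <= n)%nat -> (1 <= b <= n)%nat ->
  ((a + (n - b)) mod n = 0)%nat -> a = b.
Proof.
  intros Ha Hb H. apply Nat.Div0.div_exact in H.
  set (q := ((a + (n - b)) / n)%nat) in H. destruct q as [|[|q]]; nia.
Qed.

Lemma RtoC_INR_neq_0 n : (0 < n)%nat -> RtoC (INR n) <> 0.
Proof. intros Hn E. apply RtoC_inj in E. revert E. apply not_0_INR. lia. Qed.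

Lemma Cmult_eq_reg_l (a x y : C) : a <> 0 -> (a * x = a * y)%C -> x = y.
Proof.
  intros Ha E. replace x with (/ a * (a * x))%C by (now field). rewrite E. now field.
Qed.

(** Pairing with the conjugate of character [e l], written with exponent [n - e l], leaves [n * v l]
    by orthogonality. *)
Lemma characters_independent n t (e : nat -> nat) (v : nat -> C) :
  (forall k, (k < t)%nat -> (1 <= e k <= n)%nat) ->
  (forall k l, (k < t)%nat -> (l < t)%nat -> e k = e l -> k = l) ->
  (forall i, (i < n)%nat -> lsum (seq 0 t) (fun k => omega n ^ (i * e k) * v k)%C = 0) ->
  forall l, (l < t)%nat -> v l = 0.
Proof.
  intros He Hinj H l Hl.
  assert (Hn : (0 < n)%nat) by (specialize (He l Hl); lia).
  apply (Cmult_eq_reg_l (RtoC (INR n))); [now apply RtoC_INR_neq_0|].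
  rewrite Cmult_0_r.
  transitivity (lsum (seq 0 n) (fun i => lsum (seq 0 t)
    (fun k => omega n ^ (i * (n - e l)) * (omega n ^ (i * e k) * v k))))%C.
  - rewrite lsum_swap.
    rewrite (lsum_single (seq 0 t) _ l); [| apply seq_NoDup | apply in_seq; lia |].
    + rewrite <- (omega_sum_n n (e l + (n - e l))), Cmult_comm, <- lsum_scal.
      * apply lsum_ext. intros i _. rewrite Nat.mul_add_distr_l, Cpow_add_r. ring.
      * assumption.
      * specialize (He l Hl). replace (e l + (n - e l))%nat with n by lia. apply Nat.Div0.mod_same.
    + intros k Hk Hkl. apply in_seq in Hk.
      rewrite (lsum_ext _ _ (fun i => v k * omega n ^ (i * (e k + (n - e l))))%C).
      * rewrite lsum_scal, omega_sum_0; [ring | assumption |].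
        intros E. apply Hkl, Hinj; [lia | assumption |].
        apply (mod_shift_eq_0 n); [apply He; lia | apply He; lia | assumption].
      * intros i _. rewrite Nat.mul_add_distr_l, Cpow_add_r. ring.
  - apply lsum_zero. intros i Hi. apply in_seq in Hi.
    rewrite lsum_scal, H by lia. ring.
Qed.

(** Fourier inversion: a double sum over positions and frequencies equals [n * gam l] when
    frequencies are summed first. When positions are summed first only frequency 0 survives, and the
    result is independent of [l]. *)
Lemma fourier_constant n (gam : nat -> C) :
  (forall p, (1 <= p < n)%nat -> lsum (seq 0 n) (fun i => gam i * omega n ^ (i * p))%C = 0) ->
  forall i l, (i < n)%nat -> (l < n)%nat -> gam i = gam l.
Proof.
  intros H.
  assert (E : forall l, (l < n)%nat -> (RtoC (INR n) * gam l)%C = lsum (seq 0 n) gam).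
  { intros l Hl.
    transitivity (lsum (seq 0 n) (fun i => lsum (seq 0 n)
      (fun p => omega n ^ (p * (n - l)) * (gam i * omega n ^ (i * p)))))%C.
    - rewrite (lsum_single (seq 0 n) _ l); [| apply seq_NoDup | apply in_seq; lia |].
      + rewrite <- (omega_sum_n n (l + (n - l))), Cmult_comm, <- lsum_scal.
        * apply lsum_ext. intros p _.
          rewrite Nat.mul_add_distr_l, Cpow_add_r, (Nat.mul_comm l). ring.
        * lia.
        * replace (l + (n - l))%nat with n by lia. apply Nat.Div0.mod_same.
      + intros k Hk Hkl. apply in_seq in Hk.
        rewrite (lsum_ext _ _ (fun p => gam k * omega n ^ (p * (k + (n - l))))%C).
        * rewrite lsum_scal, omega_sum_0; [ring | lia |].
          intros E. apply Hkl. apply Nat.Div0.div_exact in E.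
          set (q := ((k + (n - l)) / n)%nat) in E. destruct q as [|[|q]]; nia.
        * intros p _. rewrite Nat.mul_add_distr_l, Cpow_add_r, (Nat.mul_comm k). ring.
    - rewrite lsum_swap.
      rewrite (lsum_single (seq 0 n) _ 0%nat); [| apply seq_NoDup | apply in_seq; lia |].
      + apply lsum_ext. intros i _. rewrite Nat.mul_0_r. simpl. ring.
      + intros p Hp Hp0. apply in_seq in Hp. rewrite lsum_scal, H by lia. ring. }
  intros i l Hi Hl. apply (Cmult_eq_reg_l (RtoC (INR n))).
  - apply RtoC_INR_neq_0. lia.
  - now rewrite !E.
Qed.

(* The excluded exponents are n - f for f = min (k N) (n - 1 - N), k < n - t: multiples of N, so that
   the sums (j + 1) + f with j < N fill {1, ..., n - 1} without reaching n. *)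
Lemma exponents n t N : (1 <= N)%nat -> (N <= t)%nat -> (t < n)%nat -> (n - 1 <= N * (n - t))%nat ->
  exists e : nat -> nat,
    (forall k, (k < t)%nat -> (1 <= e k <= n)%nat) /\
    (forall k l, (k < t)%nat -> (l < t)%nat -> e k = e l -> k = l) /\
    (forall j, (j < N)%nat -> e j = S j) /\
    forall p, (1 <= p < n)%nat -> exists j f, (j < N)%nat /\ p = (S j + f)%nat /\
      forall k, (k < t)%nat -> ((e k + f) mod n <> 0)%nat.
Proof.
  intros HN HNt Htn Hc.
  set (F k := Nat.min (k * N) (n - 1 - N)).
  set (bad := map (fun k => n - F k)%nat (seq 0 (n - t))).
  set (good := filter (fun x => if in_dec Nat.eq_dec x bad then false else true) (seq (S N) (n - N))).
  assert (Hgood : forall x, In x good <-> (N < x <= n)%nat /\ ~ In x bad).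
  { intros x. unfold good. rewrite filter_In, in_seq. destruct in_dec; intuition (easy || lia). }
  (* At most [n - t] of the [n - N] numbers above [N] are excluded, so at least [t - N] remain to
     complete 1, ..., [N] to [t] exponents. *)
  assert (Hlen : (n - N <= (n - t) + length good)%nat).
  { replace (n - N)%nat with (length (seq (S N) (n - N))) at 1 by apply length_seq.
    replace (n - t)%nat with (length bad) by (unfold bad; rewrite length_map; apply length_seq).
    rewrite <- length_app. apply NoDup_incl_length; [apply seq_NoDup|].
    intros x Hx. apply in_seq in Hx. apply in_or_app.
    destruct (in_dec Nat.eq_dec x bad); [now left | right; apply Hgood; split; [lia | assumption]]. }
  set (es := seq 1 N ++ good).
  assert (Hes : (t <= length es)%nat) by (unfold es; rewrite length_app, length_seq; lia).
  assert (Hnd : NoDup es).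
  { apply NoDup_app; [apply seq_NoDup | apply NoDup_filter, seq_NoDup |].
    intros x Hx Hx'. apply in_seq in Hx. apply Hgood in Hx'. lia. }
  assert (Hin : forall k, (k < t)%nat -> In (nth k es O) es) by (intros; apply nth_In; lia).
  assert (Hrange : forall x, In x es -> (1 <= x <= n)%nat /\ ~ In x bad).
  { intros x Hx. apply in_app_or in Hx. destruct Hx as [Hx|Hx].
    - apply in_seq in Hx. split; [lia|]. intros Hb. apply in_map_iff in Hb.
      destruct Hb as [k [Hk _]]. assert (F k <= n - 1 - N)%nat by apply Nat.le_min_r. lia.
    - apply Hgood in Hx. split; [lia | apply Hx]. }
  exists (fun k => nth k es O). split; [|split; [|split]].
  - intros k Hk. now apply Hrange, Hin.
  - intros k l Hk Hl E. apply (proj1 (NoDup_nth es O)); [assumption | lia | lia | assumption].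
  - intros j Hj. unfold es. rewrite app_nth1 by (rewrite length_seq; lia). now rewrite seq_nth.
  - intros p Hp.
    (* If [F k = k * N], then [j] is the remainder of [p - 1] modulo [N]. If the minimum is
       [n - 1 - N], then [j < N] because [p < n]. Also [k < n - t], as
       [k * N <= p - 1 < N * (n - t)]. *)
    set (k := ((p - 1) / N)%nat).
    assert (Hk1 := Nat.div_mod (p - 1) N ltac:(lia)).
    assert (Hk2 := Nat.mod_upper_bound (p - 1) N ltac:(lia)).
    fold k in Hk1.
    assert (Hk : (k < n - t)%nat) by nia.
    exists (p - 1 - F k)%nat, (F k).
    assert (HF : (F k <= p - 1)%nat) by (unfold F; nia).
    split; [unfold F; nia|]. split; [lia|].
    intros l Hl E.
    destruct (Hrange _ (Hin l Hl)) as [H1 H2]. apply H2.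
    apply in_map_iff. exists k. split; [|apply in_seq; lia].
    assert (HFn : (F k <= n - 1 - N)%nat) by apply Nat.le_min_r.
    apply Nat.Div0.div_exact in E.
    (* The sum lies strictly between 0 and [2 * n], so divisibility by [n] forces the exponent to be
       the excluded [n - F k]. *)
    set (q := ((nth l es O + F k) / n)%nat) in E. destruct q as [|[|q]]; nia.
Qed.

Lemma fourier_example n t N (e : nat -> nat) (gam : nat -> C) (v : nat -> nat -> C) :
  (0 < n)%nat ->
  (forall k, (k < t)%nat -> (1 <= e k <= n)%nat) ->
  (forall k l, (k < t)%nat -> (l < t)%nat -> e k = e l -> k = l) ->
  (forall p, (1 <= p < n)%nat -> exists j f, (j < N)%nat /\ p = (S j + f)%nat /\
      forall k, (k < t)%nat -> ((e k + f) mod n <> 0)%nat) ->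
  (forall i j, (i < n)%nat -> (j < N)%nat ->
     lsum (seq 0 t) (fun k => omega n ^ (i * e k) * v k j)%C = (gam i * omega n ^ (i * S j))%C) ->
  gam O = 0 ->
  (forall i, (i < n)%nat -> gam i = 0) /\
  (forall k j, (k < t)%nat -> (j < N)%nat -> v k j = 0).
Proof.
  intros Hn He Hinj Hcov H Hg0.
  assert (Hg : forall i, (i < n)%nat -> gam i = 0).
  { intros i Hi. rewrite <- Hg0. apply (fourier_constant n); [|assumption|assumption].
    intros p Hp. destruct (Hcov p Hp) as [j [f [Hj [-> Hf]]]].
    (* As [p = S j + f], this coefficient of [gam] is column [j] of the equation paired with
       [omega n ^ (i * f)], and every character on the left sums to zero against it. *)
    rewrite (lsum_ext _ _ (fun i => lsum (seq 0 t)
      (fun k => omega n ^ (i * f) * (omega n ^ (i * e k) * v k j))))%C.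
    - rewrite lsum_swap. apply lsum_zero. intros k Hk. apply in_seq in Hk.
      rewrite (lsum_ext _ _ (fun i => v k j * omega n ^ (i * (e k + f)))%C).
      + rewrite lsum_scal, omega_sum_0; [ring | assumption | apply Hf; lia].
      + intros l _. rewrite Nat.mul_add_distr_l, Cpow_add_r. ring.
    - intros l Hl. apply in_seq in Hl.
      rewrite lsum_scal, H, Nat.mul_add_distr_l, Cpow_add_r by (assumption || lia). ring. }
  split; [assumption|].
  intros k j Hk Hj. apply (characters_independent n t e (fun k => v k j)); [assumption..| |assumption].
  intros i Hi. rewrite H, Hg by assumption. ring.
Qed.

(** * Generic identifiability *)

Lemma NoDup_flat_map_map {A B T : Type} (f : A -> B -> T) l l' :
  (forall a b a' b', f a b = f a' b' -> a = a' /\ b = b') ->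
  NoDup l -> NoDup l' -> NoDup (flat_map (fun a => map (f a) l') l).
Proof.
  intros Hf Hl Hl'. induction Hl as [|a l Ha Hl IH]; simpl; [constructor|].
  apply NoDup_app; [|assumption|].
  - apply Injective_map_NoDup; [|assumption]. intros b b' E. now apply Hf in E.
  - intros x Hx Hx'. apply in_map_iff in Hx. destruct Hx as [b [<- _]].
    apply in_flat_map in Hx'. destruct Hx' as [a' [Ha' Hx']].
    apply in_map_iff in Hx'. destruct Hx' as [b' [E _]].
    apply Hf in E. destruct E as [-> _]. contradiction.
Qed.

Lemma NoDup_dom_param n m s N : NoDup (dom_param n m s N).
Proof.
  unfold dom_param. repeat apply NoDup_app.
  - apply Injective_map_NoDup; [intros i j E; congruence | apply seq_NoDup].
  - apply NoDup_flat_map_map; [intros a b a' b' E; split; congruence | apply seq_NoDup | apply seq_NoDup].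
  - apply NoDup_flat_map_map; [intros a b a' b' E; split; congruence | apply seq_NoDup | apply seq_NoDup].
  - intros x Hx Hx'. apply in_flat_map in Hx. destruct Hx as [i [_ Hx]].
    apply in_flat_map in Hx'. destruct Hx' as [j [_ Hx']].
    apply in_map_iff in Hx. apply in_map_iff in Hx'.
    destruct Hx as [k [<- _]], Hx' as [l [E _]]. discriminate E.
  - intros x Hx Hx'. apply in_map_iff in Hx. destruct Hx as [i [<- _]].
    apply in_app_or in Hx'. destruct Hx' as [Hx'|Hx']; apply in_flat_map in Hx';
      destruct Hx' as [j [_ Hx']]; apply in_map_iff in Hx'; destruct Hx' as [l [E _]]; discriminate E.
Qed.

Lemma in_dom_lam n m s N i : (i < n)%nat -> In (Ilam i) (dom_param n m s N).
Proof. intros Hi. apply in_or_app. left. apply in_map, in_seq. lia. Qed.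

Lemma in_dom_A n m s N i k : (i < n)%nat -> (k < m)%nat -> In (IA i k) (dom_param n m s N).
Proof.
  intros Hi Hk. apply in_or_app. right. apply in_or_app. left.
  apply in_flat_map. exists i. split; [apply in_seq; lia | apply in_map, in_seq; lia].
Qed.

Lemma in_dom_Y n m s N r j : (r < s)%nat -> (j < N)%nat -> In (IY r j) (dom_param n m s N).
Proof.
  intros Hr Hj. apply in_or_app. right. apply in_or_app. right.
  apply in_flat_map. exists r. split; [apply in_seq; lia | apply in_map, in_seq; lia].
Qed.

(** The example prescribes a column of [A] by its place in [K], whereas the coordinates of [A] carry
    the column number itself; [pos] translates. *)
Lemma position (K : list nat) : NoDup K ->
  exists pos : nat -> nat, forall k, (k < length K)%nat -> pos (nth k K O) = k.
Proof.
  induction 1 as [|x K Hx Hnd [pos Hpos]].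
  - exists (fun _ => O). simpl. lia.
  - exists (fun c => if Nat.eq_dec c x then O else S (pos c)).
    intros [|k] Hk; simpl in *.
    + now destruct Nat.eq_dec.
    + destruct Nat.eq_dec as [E|_].
      * destruct Hx. rewrite <- E. apply nth_In. lia.
      * rewrite Hpos; lia.
Qed.

(** Only finitely many supports occur, so a finite union of exceptional sets suffices. *)
Lemma short_lists s m : exists L : list (list nat), forall l,
  (length l <= s)%nat -> (forall k, In k l -> (k < m)%nat) -> In l L.
Proof.
  induction s as [|s [L IH]].
  - exists [[]]. intros [|x l] H _; [now left | simpl in H; lia].
  - exists ([] :: flat_map (fun k => map (cons k) L) (seq 0 m)). intros [|x l] H Hm; [now left|].
    right. apply in_flat_map. exists x. split; [apply in_seq; split; [lia | apply Hm; now left]|].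
    apply in_map, IH; [simpl in H; lia | intros k Hk; apply Hm; now right].
Qed.

(* Entry (i, j) of A_J0 Y, the submatrix of A with columns J0 times the nonzero rows Y of X0. *)
Definition AY (J0 : list nat) (s : nat) (z : idx -> C) (i j : nat) : C :=
  lsum (seq 0 s) (fun r => z (IA i (nth r J0 O)) * z (IY r j))%C.

(** Here [gam] and [x] stand for the difference between a solution and the multiple of the trivial
    solution that agrees with it in [gam O]. Identifiability for supports inside [K] means that this
    difference vanishes. *)
Definition rigid (n N s : nat) (J0 K : list nat) (z : idx -> C) : Prop :=
  forall (gam : nat -> C) (x : nat -> nat -> C), gam O = 0 ->
    (forall i j, (i < n)%nat -> (j < N)%nat ->
       lsum (seq 0 (length K)) (fun k => z (IA i (nth k K O)) * x k j)%C = (gam i * AY J0 s z i j)%C) ->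
    (forall i, (i < n)%nat -> gam i = 0) /\
    (forall k j, (k < length K)%nat -> (j < N)%nat -> x k j = 0).

Lemma polyfun_AY n m s N J0 i j : (i < n)%nat -> (j < N)%nat -> length J0 = s ->
  (forall k, In k J0 -> (k < m)%nat) ->
  polyfun (fun x => In x (dom_param n m s N)) (fun z => AY J0 s z i j).
Proof.
  intros Hi Hj HJ Hm. unfold AY.
  apply polyfun_lsum with (f := fun r z => (z (IA i (nth r J0 O)) * z (IY r j))%C).
  intros r Hr. apply in_seq in Hr.
  apply (pf_mul _ (fun z => z (IA i (nth r J0 O))) (fun z => z (IY r j))); apply pf_coord.
  - apply in_dom_A; [assumption | apply Hm, nth_In; lia].
  - apply in_dom_Y; lia.
Qed.

Lemma rigid_generic n m s N (J0 K' : list nat) :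
  (0 < N)%nat -> (N <= s)%nat -> length J0 = s -> NoDup (J0 ++ K') ->
  (forall k, In k (J0 ++ K') -> (k < m)%nat) ->
  (length (J0 ++ K') < n)%nat -> (n - 1 <= N * (n - length (J0 ++ K')))%nat ->
  locally_negligible (dom_param n m s N) (fun z => ~ rigid n N s J0 (J0 ++ K') z).
Proof.
  intros HN HNs HJ0 Hnd Hm Htn Hcnt.
  set (K := J0 ++ K') in *. set (t := length K) in *.
  assert (Hst : (s <= t)%nat) by (unfold t, K; rewrite length_app; lia).
  destruct (exponents n t N) as [e [He1 [He2 [He3 He4]]]]; try lia.
  destruct (position K Hnd) as [pos Hpos].
  (* The Fourier example: column [c] of [A] is the character of exponent [e (pos c)], and [Y] has
     the identity in its first [N] rows and zeros below. *)
  set (w := fun x => match x with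
    | Ilam _ => RtoC 1
    | IA i c => (omega n ^ (i * e (pos c)))%C
    | IY r j => if Nat.eq_dec r j then RtoC 1 else RtoC 0
    end).
  (* The unknowns are [gam i] for [i >= 1], since [gam O] is normalised to zero, and all entries of
     [x]. *)
  set (cols := map (@inl nat (nat * nat)) (seq 1 (n - 1))
               ++ map (@inr nat (nat * nat)) (list_prod (seq 0 t) (seq 0 N))).
  assert (Hcols : NoDup cols).
  { apply NoDup_app.
    - apply Injective_map_NoDup; [intros a b E; congruence | apply seq_NoDup].
    - apply Injective_map_NoDup; [intros a b E; congruence|].
      rewrite list_prod_as_flat_map.
      apply NoDup_flat_map_map; [intros a b a' b' E; split; congruence | apply seq_NoDup | apply seq_NoDup].
    - intros x Hx Hx'. apply in_map_iff in Hx. apply in_map_iff in Hx'.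
      destruct Hx as [a [<- _]], Hx' as [b [E _]]. discriminate E. }
  set (gam (v : nat + nat * nat -> C) i := match i with O => RtoC 0 | S _ => v (inl i) end).
  set (g (row : nat * nat) (z : idx -> C) (v : nat + nat * nat -> C) :=
    if andb (fst row <? n)%nat (snd row <? N)%nat then
      (lsum (seq 0 t) (fun k => z (IA (fst row) (nth k K O)) * v (inr (k, snd row)))
       + (- AY J0 s z (fst row) (snd row)) * gam v (fst row))%C
    else RtoC 0).
  destruct (linform_injective_generic (fun x => In x (dom_param n m s N)) cols g w Hcols)
    as [F [HF1 [HF2 HF3]]].
  - intros [i j]. unfold g. simpl.
    destruct (Nat.ltb_spec i n) as [Hi|Hi]; simpl; [|apply linform_zero].
    destruct (Nat.ltb_spec j N) as [Hj|Hj]; simpl; [|apply linform_zero].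
    apply (linform_add _ cols
      (fun z v => lsum (seq 0 t) (fun k => z (IA i (nth k K O)) * v (inr (k, j))))%C
      (fun z v => - AY J0 s z i j * gam v i)%C).
    + apply (linform_lsum _ cols (seq 0 t) (fun k z v => z (IA i (nth k K O)) * v (inr (k, j)))%C).
      intros k Hk. apply in_seq in Hk.
      apply (linform_scal _ cols (fun z => z (IA i (nth k K O))) (fun _ v => v (inr (k, j)))).
      * apply pf_coord, in_dom_A; [assumption|]. apply Hm, nth_In. unfold t in Hk. lia.
      * apply linform_var; [assumption|]. apply in_or_app. right. apply in_map, in_prod; apply in_seq; lia.
    + apply (linform_scal _ cols (fun z => - AY J0 s z i j)%C (fun _ v => gam v i)).
      * apply polyfun_opp, polyfun_AY; try assumption.
        intros k Hk. apply Hm, in_or_app. now left.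
      * destruct i as [|i]; simpl; [apply linform_zero|].
        apply linform_var; [assumption|]. apply in_or_app. left. apply in_map, in_seq. lia.
  - intros v Hv.
    destruct (fourier_example n t N e (gam v) (fun k j => v (inr (k, j)))) as [G1 G2];
      try assumption; [lia | | reflexivity |].
    + intros i j Hi Hj. specialize (Hv (i, j)). unfold g in Hv. simpl in Hv.
      apply Nat.ltb_lt in Hi. apply Nat.ltb_lt in Hj. rewrite Hi, Hj in Hv. simpl in Hv.
      apply Nat.ltb_lt in Hi. apply Nat.ltb_lt in Hj.
      replace (AY J0 s w i j) with (omega n ^ (i * S j))%C in Hv.
      * apply Ceq_minus. rewrite <- Hv. unfold Cminus.
        rewrite (lsum_ext _ _ (fun k => w (IA i (nth k K O)) * v (inr (k, j))))%C; [unfold w; ring|].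
        intros k Hk. apply in_seq in Hk. simpl. rewrite Hpos; [reflexivity | unfold t in Hk; lia].
      (* Only row [j] of [Y] meets column [j]. Since [J0] comes first in [K], the matching column of
         [A] has exponent [e j = S j]. *)
      * unfold AY. rewrite (lsum_single _ _ j); [| apply seq_NoDup | apply in_seq; lia |].
        -- simpl. destruct Nat.eq_dec; [|congruence].
           replace (nth j J0 O) with (nth j K O) by (unfold K; rewrite app_nth1; [reflexivity | lia]).
           rewrite Hpos, He3 by (unfold t in Hst; lia). ring.
        -- intros r _ Hrj. simpl. destruct Nat.eq_dec; [congruence | ring].
    + intros c Hc. apply in_app_or in Hc. destruct Hc as [Hc|Hc].
      * apply in_map_iff in Hc. destruct Hc as [i [<- Hi]]. apply in_seq in Hi.
        destruct i as [|i]; [lia|]. apply (G1 (S i)). lia.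
      * apply in_map_iff in Hc. destruct Hc as [[k j] [<- Hkj]].
        apply in_prod_iff in Hkj. destruct Hkj as [Hk Hj]. apply in_seq in Hk, Hj.
        apply (G2 k j); lia.
  - intros M eps HM Heps.
    destruct (polyfun_zero_negligible _ F w (NoDup_dom_param n m s N) HF1 HF2 M eps HM Heps)
      as [L [HL1 [HL2 HL3]]].
    exists L. split; [assumption|]. split; [assumption|].
    intros z Hz. apply HL3. destruct (Ceq_dec (F z) 0) as [|HFz]; [assumption|].
    destruct Hz. intros gm x Hg0 H.
    set (v := fun u : nat + nat * nat => match u with inl i => gm i | inr (k, j) => x k j end).
    assert (Hgam : forall i, gam v i = gm i) by (intros [|i]; [symmetry; exact Hg0 | reflexivity]).
    assert (Hv : forall c, In c cols -> v c = 0).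
    { apply (HF3 z HFz). intros [i j]. unfold g. simpl.
      destruct (Nat.ltb_spec i n) as [Hi|Hi]; simpl; [|reflexivity].
      destruct (Nat.ltb_spec j N) as [Hj|Hj]; simpl; [|reflexivity].
      rewrite Hgam. change (length K) with t in H. rewrite H by assumption. ring. }
    split.
    + intros [|i] Hi; [assumption|]. apply (Hv (inl (S i))).
      apply in_or_app. left. apply in_map, in_seq. lia.
    + intros k j Hk Hj. apply (Hv (inr (k, j))).
      apply in_or_app. right. apply in_map, in_prod; apply in_seq; [unfold t|]; lia.
Qed.

(** Where this product is nonzero for all [i], no solution can have a zero entry in its diagonal, so
    the quotients of [lam0] by [lam] make sense. *)
Lemma lam_AY_generic n m s N J0 i : (i < n)%nat -> (0 < N)%nat -> (0 < s)%nat -> length J0 = s ->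
  (forall k, In k J0 -> (k < m)%nat) ->
  locally_negligible (dom_param n m s N) (fun z => (z (Ilam i) * AY J0 s z i O)%C = 0).
Proof.
  intros Hi HN Hs HJ Hm.
  apply (polyfun_zero_negligible _ (fun z => z (Ilam i) * AY J0 s z i O)%C
    (fun x => match x with IY (S _) _ => RtoC 0 | _ => RtoC 1 end)).
  - apply NoDup_dom_param.
  - apply (pf_mul _ (fun z => z (Ilam i)) (fun z => AY J0 s z i O)).
    + now apply pf_coord, in_dom_lam.
    + now apply polyfun_AY.
  - unfold AY. rewrite (lsum_single _ _ O); [| apply seq_NoDup | apply in_seq; lia |].
    + rewrite !Cmult_1_l. apply C1_nz.
    + intros [|r] _ Hr; [congruence | ring].
Qed.

Lemma Cinv_inv (x : C) : x <> 0 -> (Defs.Cinv (/ x)%C : C) = x.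
Proof.
  intros Hx. replace (Defs.Cinv (/ x)%C : C) with (/ / x)%C.
  - now field.
  - unfold Defs.Cinv. unfold Complex.Cinv at 1. f_equal; f_equal; ring.
Qed.

Theorem theorem2 :
  forall n m s N : nat,
    (0 < n)%nat -> (0 < m)%nat -> (0 < s)%nat -> (0 < N)%nat ->
    (s <= m)%nat -> (2 * s < n)%nat ->
    (* (n-1)/(n-2s) <= N, cleared of the positive denominator *)
    (n - 1 <= N * (n - 2 * s))%nat -> (N <= s)%nat ->
    forall J0 : list nat,
      NoDup J0 -> length J0 = s -> (forall k, In k J0 -> (k < m)%nat) ->
      exists E : (idx -> Cx) -> Prop,
        null_set (dom_param n m s N) E /\
        forall (lam0 : nat -> Cx) (A X0 : nat -> nat -> Cx),
          (forall k j, (k < m)%nat -> (j < N)%nat -> ~ In k J0 -> X0 k j = C0) ->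
          ~ E (pack lam0 A (fun r j => X0 (nth r J0 O) j)) ->
          forall (lam : nat -> Cx) (X : nat -> nat -> Cx),
            at_most_s_rows m N s X ->
            (forall i j, (i < n)%nat -> (j < N)%nat ->
               diagAX m lam A X i j = diagAX m lam0 A X0 i j) ->
            exists sigma : Cx,
              sigma <> C0 /\
              (forall i, (i < n)%nat -> lam i = Cmul sigma (lam0 i)) /\
              (forall k j, (k < m)%nat -> (j < N)%nat ->
                 X k j = Cmul (Cinv sigma) (X0 k j)).
Proof.
  intros n m s N Hn Hm0 Hs HN Hsm Hsn Hcnt HNs J0 HndJ0 HJ0 HmJ0.
  destruct (short_lists s m) as [Ls HLs].
  (* [inl K'] treats the supports whose rows outside [J0] are [K'], [inr i] a vanishing entry of the
     data. The side conditions on [K'] make the set empty for lists that do not qualify. *)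
  set (E := fun (t : list nat + nat) (z : idx -> C) => match t with
    | inl K' => (length K' <= s)%nat /\ NoDup (J0 ++ K') /\ (forall k, In k (J0 ++ K') -> (k < m)%nat)
                /\ ~ rigid n N s J0 (J0 ++ K') z
    | inr i => (z (Ilam i) * AY J0 s z i O)%C = 0
    end).
  set (ts := map inl Ls ++ map inr (seq 0 n)).
  exists (fun z => exists t, In t ts /\ E t z). split.
  { apply locally_negligible_null.
    - unfold dom_param. destruct n; [lia | discriminate].
    - apply locally_negligible_union. intros t Ht.
      apply in_app_or in Ht. destruct Ht as [Ht|Ht]; apply in_map_iff in Ht.
      + destruct Ht as [K' [<- _]]. intros M eps HM Heps. simpl.
        destruct (classic ((length K' <= s)%nat /\ NoDup (J0 ++ K') /\
                           (forall k, In k (J0 ++ K') -> (k < m)%nat))) as [[H1 [H2 H3]]|Hno].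
        * assert (Hlen : (length (J0 ++ K') <= 2 * s)%nat) by (rewrite length_app; lia).
          destruct (rigid_generic n m s N J0 K' HN HNs HJ0 H2 H3) with (M := M) (eps := eps)
            as [L [HL1 [HL2 HL3]]]; [lia | nia | assumption | assumption |].
          exists L. split; [assumption|]. split; [assumption|]. intros z Hz. apply HL3, Hz.
        * exists []. split; [easy|]. split; [unfold total_vol; simpl; lra|].
          intros z Hz. destruct Hno. tauto.
      + destruct Ht as [i [<- Hi]]. apply in_seq in Hi. apply lam_AY_generic; (assumption || lia). }
  intros lam0 A X0 HX0 HE lam X [J [HJs HJ]] Heq.
  set (Y := fun r j => X0 (nth r J0 O) j) in HE.
  set (z := pack lam0 A Y) in HE.
  set (S1 := fun i j => lsum (seq 0 m) (fun k => A i k * X k j)%C).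
  assert (HAY : forall i j, (j < N)%nat -> lsum (seq 0 m) (fun k => A i k * X0 k j)%C = AY J0 s z i j).
  { intros i j Hj. rewrite (lsum_restrict m J0); [|assumption|assumption|].
    - rewrite lsum_nth, HJ0. reflexivity.
    - intros k Hk Hk'. rewrite HX0 by assumption. change C0 with (RtoC 0). ring. }
  assert (Heq' : forall i j, (i < n)%nat -> (j < N)%nat -> (lam i * S1 i j)%C = (lam0 i * AY J0 s z i j)%C).
  { intros i j Hi Hj. specialize (Heq i j Hi Hj). unfold diagAX in Heq.
    rewrite !Csum_lsum in Heq. rewrite <- HAY by assumption. exact Heq. }
  assert (Hnz : forall i, (i < n)%nat -> (lam0 i * AY J0 s z i O)%C <> 0).
  { intros i Hi H0. apply HE. exists (inr i). split; [|exact H0].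
    apply in_or_app. right. apply in_map, in_seq. lia. }
  assert (Hlam0 : forall i, (i < n)%nat -> lam0 i <> RtoC 0).
  { intros i Hi H0. apply (Hnz i Hi). rewrite H0. ring. }
  (* A zero of [lam] would annihilate the left side of the equation at [(i, 0)], whose right side is
     nonzero. *)
  assert (Hlam : forall i, (i < n)%nat -> lam i <> RtoC 0).
  { intros i Hi H0. apply (Hnz i Hi). rewrite <- Heq', H0 by assumption. ring. }
  set (gm := fun i => (lam0 i / lam i)%C).
  assert (HS1 : forall i j, (i < n)%nat -> (j < N)%nat -> S1 i j = (gm i * AY J0 s z i j)%C).
  { intros i j Hi Hj. apply (Cmult_eq_reg_l (lam i)); [auto|]. rewrite Heq' by assumption.
    unfold gm. field. auto. }
  (* The row support of [X] outside [J0], freed of repetitions and of indices beyond [m]. *)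
  set (K' := nodup Nat.eq_dec (filter (fun k => andb (k <? m)%nat (if in_dec Nat.eq_dec k J0 then false else true)) J)).
  assert (HK' : forall k, In k K' <-> In k J /\ (k < m)%nat /\ ~ In k J0).
  { intros k. unfold K'. rewrite nodup_In, filter_In, Bool.andb_true_iff, Nat.ltb_lt.
    destruct in_dec; intuition discriminate. }
  assert (HK's : (length K' <= s)%nat).
  { apply Nat.le_trans with (length J); [|assumption].
    apply NoDup_incl_length; [apply NoDup_nodup|]. intros k Hk. now apply HK'. }
  set (K := J0 ++ K').
  assert (HndK : NoDup K).
  { apply NoDup_app; [assumption | apply NoDup_nodup|]. intros k Hk Hk'. now apply HK' in Hk'. }
  assert (HmK : forall k, In k K -> (k < m)%nat).
  { intros k Hk. apply in_app_or in Hk. destruct Hk as [Hk|Hk]; [auto | now apply HK' in Hk]. }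
  assert (HXK : forall k j, (k < m)%nat -> (j < N)%nat -> ~ In k K -> X k j = RtoC 0).
  { intros k j Hk Hj Hkk. destruct (Ceq_dec (X k j) 0) as [|Hne]; [assumption|].
    destruct Hkk. apply in_or_app.
    destruct (in_dec Nat.eq_dec k J0); [now left | right].
    apply HK'. split; [|now split]. apply HJ; [assumption|]. now exists j. }
  assert (Hrigid : rigid n N s J0 K z).
  { apply NNPP. intros Hno. apply HE. exists (inl K'). split; [|now repeat split].
    apply in_or_app. left. apply in_map, HLs; [assumption|]. intros k Hk. now apply HK' in Hk. }
  (* Rigidity applied to the given solution minus [gm O] times the trivial one; its entry at 0
     vanishes by construction. *)
  destruct (Hrigid (fun i => gm i - gm O)%C
    (fun k j => X (nth k K O) j - gm O * X0 (nth k K O) j)%C) as [R1 R2].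
  { ring. }
  { intros i j Hi Hj.
    change (fun k => z (IA i (nth k K O)) * (X (nth k K O) j - gm O * X0 (nth k K O) j))%C
      with (fun k => (fun c => A i c * (X c j - gm O * X0 c j))%C (nth k K O)).
    rewrite <- lsum_nth, <- (lsum_restrict m); [|assumption|assumption|].
    - transitivity (S1 i j - gm O * AY J0 s z i j)%C; [|rewrite HS1 by assumption; ring].
      rewrite <- HAY by assumption. unfold S1.
      replace (- (gm O * lsum (seq 0 m) (fun k => A i k * X0 k j)))%C
        with ((- gm O) * lsum (seq 0 m) (fun k => A i k * X0 k j))%C by ring.
      unfold Cminus at 2.
      replace (- (gm O * lsum (seq 0 m) (fun k => A i k * X0 k j)))%C
        with ((- gm O) * lsum (seq 0 m) (fun k => A i k * X0 k j))%C by ring.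
      rewrite <- lsum_scal, <- lsum_add. apply lsum_ext. intros; ring.
    - intros k Hk Hkk. rewrite HXK, HX0; try assumption.
      + change C0 with (RtoC 0). ring.
      + intros H. apply Hkk, in_or_app. now left. }
  assert (Hg0 : gm O <> 0).
  { unfold gm, Cdiv. apply Cmult_neq_0; [auto|]. intros H0. apply C1_nz.
    rewrite <- (Cinv_r (lam O)) by auto. rewrite H0. ring. }
  assert (Hgi : forall i, (i < n)%nat -> gm i = gm O) by (intros i Hi; now apply Ceq_minus, R1).
  (* Since [gm] is constant, [lam i = lam0 i / gm O], and rigidity gives [X = gm O * X0] on the rows
     in [K]; both sides vanish on the others. *)
  exists (/ gm O)%C. split; [|split].
  - intros H0. apply C1_nz. rewrite <- (Cinv_r (gm O)) by assumption.
    change (/ gm O = 0)%C in H0. rewrite H0. ring.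
  - intros i Hi. change (@eq C (lam i) (/ gm O * lam0 i)%C). rewrite <- (Hgi i Hi). unfold gm. symmetry.
    field. auto.
  - intros k j Hk Hj.
    change (@eq C (X k j) (Defs.Cinv (/ gm O) * X0 k j)%C).
    rewrite Cinv_inv by assumption.
    destruct (in_dec Nat.eq_dec k K) as [HkK|HkK].
    + apply In_nth with (d := O) in HkK. destruct HkK as [l [Hl <-]].
      apply Ceq_minus. now apply R2.
    + rewrite HXK, HX0; try assumption.
      * change C0 with (RtoC 0). ring.
      * intros H. apply HkK, in_or_app. now left.
Qed.
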